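(* Let $k$ be an algebraically closed field of characteristic $p>0$, let $\mathbb{H}=k((y^{\mathbb{Q}}))$ be the Hahn field with its valuation $v$, and let $K$ be a field with $k(y)\subseteq K\subseteq\mathbb{H}$ such that $(K,v)$ is Henselian, $K$ is perfect, and $K$ has no finite limits. If $L/K$ is a compositum of finitely many linearly disjoint Artin-Schreier extensions of $K$, then $\mathrm{depth}(L/K,v)=1$.
   Context: $\mathbb{H}$ is the field of formal series $s=\sum_{q\in\mathbb{Q}}\lambda_qy^q$, $\lambda_q\in k$, with well-ordered support $\mathrm{supp}(s)=\{q\mid\lambda_q\neq0\}$, and $v(s)=\min\mathrm{supp}(s)$. $K$ has no finite limits if for every $a\in K$ the set $\mathrm{supp}(a)$ has no accumulation point in $\mathbb{R}$ (so $\mathrm{supp}(a)$ is finite or its only limit is $\infty$). The field $\mathbb H$ is algebraically closed; $\overline{K}$ denotes the algebraic closure of $K$ in $\mathbb{H}$ and $\Gamma=v\overline{K}$. An Artin-Schreier extension of $K$ is $K(\alpha)$ with $\alpha\in\overline{K}$, $\alpha^p-\alpha\in K$ and $\alpha^p-\alpha\ne c^p-c$ for all $c\in K$. Extensions $K(\alpha_1),\dots,K(\alpha_n)$ are linearly disjoint over $K$ if $[K(\alpha_1,\dots,\alpha_n):K]=\prod_i[K(\alpha_i):K]$. Depth. For $\theta\in\overline{K}$ of degree $n$ over $K$ and $1\le m\le n$, let $D_m(\theta)=\{v(\theta-b)\mid b\in\overline{K},\ \deg_K b=m\}\subseteq\Gamma\cup\{\infty\}$. Define integers $1=d_0<d_1<\cdots<d_r=n$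 by $d_0=1$ and, as long as $d_{\ell-1}<n$, $d_\ell$ is the least integer $m>d_{\ell-1}$ such that some $\epsilon\in D_m(\theta)$ satisfies $\epsilon>x$ for all $x\in D_{d_{\ell-1}}(\theta)$. Then $\mathrm{depth}(\theta):=r$. (Originally, depth is defined as the common length of the Mac Lane–Vaquié chains of the valuation $f\mapsto v(f(\theta))$ on $K[x]$; by a known theorem it equals this $r$, which may be taken as the definition.) For a finite simple extension $L/K$ inside $\overline{K}$, $\mathrm{depth}(L/K,v):=\min\{\mathrm{depth}(\theta)\mid L=K(\theta)\}$. *)

(* Defs.v *)
From HB Require Import structures.
From mathcomp Require Import all_boot all_order all_algebra.
From mathcomp Require Import all_classical.
From mathcomp Require Import ring.
From mathcomp Require Import reals constructive_ereal topology normedtype.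

Set Implicit Arguments.
Unset Strict Implicit.
Unset Printing Implicit Defensive.
Import Order.TTheory GRing.Theory Num.Theory.
Import numFieldNormedType.Exports.
Local Open Scope classical_set_scope.
Local Open Scope ring_scope.

Definition well_ordered (A : set rat) : Prop :=
  forall B, B `<=` A -> B !=set0 -> exists2 m, B m & lbound B m.

Lemma well_ordered_sub A B : A `<=` B -> well_ordered B -> well_ordered A.
Proof. by move=> AB wB C CA; apply: wB; apply: subset_trans AB. Qed.

Lemma well_ordered1 a : well_ordered [set a].
Proof.
move=> B Ba [x Bx]; exists a; first by have <- := Ba _ Bx.
by move=> y /Ba ->.
Qed.

Lemma well_orderedU A B :
  well_ordered A -> well_ordered B -> well_ordered (A `|` B).
Proof.
move=> wA wB C CAB [x Cx].
have [CA0|/set0P CA] := eqVneq (C `&` A) set0.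
  apply: wB; last by exists x.
  move=> y Cy; have [Ay|//] := CAB _ Cy.
  by have : (C `&` A) y by []; rewrite CA0.
have [CB0|/set0P CB] := eqVneq (C `&` B) set0.
  apply: wA; last by exists x.
  move=> y Cy; have [//|By] := CAB _ Cy.
  by have : (C `&` B) y by []; rewrite CB0.
have [a [Ca Aa] la] := wA _ (@subIsetr _ C A) CA.
have [b [Cb Bb] lb] := wB _ (@subIsetr _ C B) CB.
have [ab|ba] := leP a b.
  exists a => // y Cy; have [Ay|By] := CAB _ Cy; first exact: la.
  by apply: (le_trans ab); apply: lb.
exists b => // y Cy; have [Ay|By] := CAB _ Cy; last exact: lb.
by apply: (le_trans (ltW ba)); apply: la.
Qed.
Arguments well_ordered1 : clear implicits.

Definition sumset (A B : set rat) : set rat :=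
  [set x | exists2 a, A a & B (x - a)].

Lemma well_ordered_sumset A B :
  well_ordered A -> well_ordered B -> well_ordered (sumset A B).
Proof.
move=> wA wB C CAB C0.
pose M x := [set t | B t /\ exists y, [/\ C y, y <= x & A (y - t)]].
pose G := [set s | A s /\ exists t, [/\ C (s + t), M (s + t) t &
   lbound (M (s + t)) t]].
have below x : C x -> exists s t, [/\ G s, C (s + t), s + t <= x &
    M (s + t) t /\ lbound (M (s + t)) t].
  move=> Cx; have [a Aa Bxa] := CAB _ Cx.
  have [t Mt lt] : exists2 t, M x t & lbound (M x) t.
    apply: wB; first by move=> t [].
    by exists (x - a); split => //; exists x; split => //; rewrite subKr.
  have [Bt [y [Cy yx Ayt]]] := Mt.
  have Myt : M y t by split => //; exists y.
  have lyt : lbound (M y) t.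
    move=> u [Bu [z [Cz zy Azu]]]; apply: lt; split => //.
    by exists z; split => //; apply: le_trans yx.
  exists (y - t), t; rewrite subrK; split => //.
  by split => //; exists t; rewrite subrK.
have [s Gs ls] : exists2 s, G s & lbound G s.
  apply: wA; first by move=> s [].
  by case: C0 => x /below[s [t [Gs _ _ _]]]; exists s.
have [As [t [Cst Mt lt]]] := Gs.
exists (s + t) => // y Cy; rewrite leNgt; apply/negP => yst.
have [u [w [Gu Cuw uwy [Mw _]]]] := below _ Cy.
suff : s + t <= y by rewrite leNgt yst.
apply: (le_trans _ uwy); apply: lerD; first exact: ls.
apply: lt; have [Bw [z [Cz zuw Azw]]] := Mw; split => //; exists z; split => //.
by apply: (le_trans zuw); apply: (le_trans uwy); apply: ltW.
Qed.

Lemma finite_pairs A B (q : rat) : well_ordered A -> well_ordered B ->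
  finite_set [set a | A a /\ B (q - a)].
Proof.
move=> wA wB; set P := [set a | _].
have wP : well_ordered P by apply: well_ordered_sub wA => a [].
pose I m := P `&` [set x | x <= m].
pose F := [set m | P m /\ finite_set (I m)].
have [P0|/set0P Pn0] := eqVneq P set0; first by rewrite P0; exact: finite_set0.
have [m0 Pm0 lm0] := wP _ (@subset_refl _ P) Pn0.
have Fm0 : F m0.
  split => //; apply: (@sub_finite_set _ _ [set m0]); last exact: finite_set1.
  by move=> x [Px /= xm0]; apply/le_anti; rewrite xm0 lm0.
have [M [PM fM] uM] : exists2 M, F M & forall x, F x -> x <= M.
  have [b] : exists2 b, (fun a => F (q - a)) b & lbound (fun a => F (q - a)) b.
    apply: wB; first by move=> b [[_ +] _]; rewrite subKr.
    by exists (q - m0); rewrite subKr.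
  move=> Fb lb; exists (q - b) => // x Fx.
  by rewrite lerBrDr addrC -lerBrDr; apply: lb; rewrite subKr.
have [R0|/set0P Rn0] := eqVneq (P `&` [set x | M < x]) set0.
  apply: sub_finite_set fM => x Px; split => //=; have [//|Mx] := leP x M.
  by have : (P `&` [set x | M < x]) x by []; rewrite R0.
have [m [Pm /= Mm] lm] := wP _ (@subIsetl _ P _) Rn0.
suff Fm : F m by have := uM _ Fm; rewrite leNgt Mm.
split => //; apply: (@sub_finite_set _ _ (I M `|` [set m])).
  move=> x [Px /= xm]; have [xM|Mx] := leP x M; [by left; split|right => /=].
  by apply/le_anti; rewrite xm lm.
by rewrite finite_setU; split => //; exact: finite_set1.
Qed.

Record hahn (k : fieldType) := Hahn {
  hcoef :> rat -> k;
  hahnP : well_ordered [set q | hcoef q != 0] }.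

HB.instance Definition _ (k : fieldType) := gen_eqMixin (hahn k).
HB.instance Definition _ (k : fieldType) := gen_choiceMixin (hahn k).

Section HahnRing.
Variable k : fieldType.
Implicit Types (s t u : hahn k) (q a b c : rat).

Definition supp s : set rat := [set q | s q != 0].

Lemma suppP s : well_ordered (supp s). Proof. exact: hahnP. Qed.
Arguments suppP : clear implicits.

Lemma hahn_ext s t : s =1 t -> s = t.
Proof.
case: s t => [f fP] [g gP] /= fg; have e : f = g by apply/funext.
by case: g / e gP {fg} => gP; congr Hahn; exact: Prop_irrelevance.
Qed.

Fact hahnC_subproof a (x : k) :
  well_ordered [set q | (if q == a then x else 0) != 0].
Proof.
apply: well_ordered_sub (well_ordered1 a) => q /=.
by have [->//|_] := eqVneq q a; rewrite eqxx.
Qed.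
(* the monomial x y^a *)
Definition hmono a (x : k) : hahn k := Hahn (@hahnC_subproof a x).
Definition hconst x := hmono 0 x.
Definition hvar := hmono 1 1.

Fact hopp_subproof s : well_ordered [set q | - s q != 0].
Proof. by apply: well_ordered_sub (suppP s) => q /=; rewrite oppr_eq0. Qed.
Definition hopp s := Hahn (@hopp_subproof s).

Fact hadd_subproof s t : well_ordered [set q | s q + t q != 0].
Proof.
apply: well_ordered_sub (well_orderedU (suppP s) (suppP t)) => q /=.
rewrite /supp /=; have [->|] := eqVneq (s q) 0; last by left.
by rewrite add0r; right.
Qed.
Definition hadd s t := Hahn (@hadd_subproof s t).

(* Only finitely many terms are nonzero (finite_pairs), so the default value 0
   that \sum_(_ \in _) takes on infinite supports never occurs. *)
Definition hmulc s t q : k := \sum_(a \in [set: rat]) s a * t (q - a).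

Lemma hmul_mem s t q a :
  s a * t (q - a) != 0 -> [set a | supp s a /\ supp t (q - a)] a.
Proof. by rewrite mulf_eq0 negb_or => /andP[]. Qed.

(* hmulc as an explicit sum over a large enough finite list *)
Lemma hmulcE s t q (r : seq rat) : uniq r ->
  (forall a, s a != 0 -> t (q - a) != 0 -> a \in r) ->
  hmulc s t q = \sum_(a <- r) s a * t (q - a).
Proof.
move=> ur rP; rewrite /hmulc (fsbigE r) //.
  by apply: eq_bigl => a; rewrite in_setT.
move=> a _; apply: contraNeq.
by rewrite mulf_eq0 negb_or => /andP[]; apply: rP.
Qed.

Lemma finite_seq (A : set rat) : finite_set A ->
  exists r : seq rat, uniq r /\ (forall a, A a <-> a \in r).
Proof.
move=> /finite_seqP[r ->]; exists (undup r); split; first exact: undup_uniq.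
by move=> a; rewrite mem_undup.
Qed.

Lemma hmulc_neq0 s t q : hmulc s t q != 0 -> sumset (supp s) (supp t) q.
Proof.
apply: contraPP => /= H; apply/negP; rewrite negbK; apply/eqP/fsbig1 => a _.
by apply: contrapT => /eqP /hmul_mem[sa ta]; apply: H; exists a.
Qed.

Fact hmul_subproof s t : well_ordered [set q | hmulc s t q != 0].
Proof.
apply: well_ordered_sub (well_ordered_sumset (suppP s) (suppP t)) => q.
exact: hmulc_neq0.
Qed.
Definition hmul s t := Hahn (@hmul_subproof s t).

Lemma haddA : associative hadd.
Proof. by move=> s t u; apply: hahn_ext => q /=; rewrite addrA. Qed.
Lemma haddC : commutative hadd.
Proof. by move=> s t; apply: hahn_ext => q /=; rewrite addrC. Qed.
Lemma hadd0 : left_id (hconst 0) hadd.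
Proof. by move=> s; apply: hahn_ext => q /=; rewrite if_same add0r. Qed.
Lemma haddN : left_inverse (hconst 0) hopp hadd.
Proof. by move=> s; apply: hahn_ext => q /=; rewrite if_same addNr. Qed.

Lemma hmulC : commutative hmul.
Proof.
move=> s t; apply: hahn_ext => q /=.
have [r [ur rP]] := finite_seq (finite_pairs q (suppP s) (suppP t)).
rewrite (@hmulcE _ _ _ r) //; last by move=> a sa ta; apply/rP; split.
rewrite (@hmulcE _ _ _ [seq q - a | a <- r]); first last.
- move=> a ta sa; rewrite -[a](subKr q); apply: map_f.
  by apply/rP; split => //; rewrite /supp /= subKr.
- by rewrite map_inj_uniq // => x y /addrI /oppr_inj.
by rewrite big_map; apply: eq_bigr => a _; rewrite subKr mulrC.
Qed.

Lemma hmulDl : left_distributive hmul hadd.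
Proof.
move=> s t u; apply: hahn_ext => q /=.
have fin v := finite_pairs q (suppP v) (suppP u).
have [r [ur rP]] : exists r : seq rat, uniq r /\ forall a,
   ([set a | supp s a /\ supp u (q - a)] `|`
    [set a | supp t a /\ supp u (q - a)]) a <-> a \in r.
  by apply: finite_seq; rewrite finite_setU.
rewrite !(@hmulcE _ _ _ r) //.
- by rewrite -big_split; apply: eq_bigr => a _ /=; rewrite mulrDl.
- by move=> a ta ua; apply/rP; right.
- by move=> a sa ua; apply/rP; left.
move=> a /= sta ua; apply/rP; case/boolP: (s a == 0) => [/eqP sa|]; last by left.
by right; split => //; move: sta; rewrite sa add0r.
Qed.

Lemma hmul1 : left_id (hconst 1) hmul.
Proof.
move=> s; apply: hahn_ext => q /=.
rewrite (@hmulcE _ _ _ [:: 0]) //; last first.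
  by move=> a /=; rewrite inE; have [//|_] := eqVneq a 0; rewrite eqxx.
by rewrite big_seq1 /= mul1r subr0.
Qed.

Lemma hmulA : associative hmul.
Proof.
move=> s t u; apply: hahn_ext => q /=.
have [r [ur rP]] := finite_seq (finite_pairs q (suppP s)
  (well_ordered_sumset (suppP t) (suppP u))).
have [r' [ur' rP']] := finite_seq (finite_pairs q (suppP u)
  (well_ordered_sumset (suppP s) (suppP t))).
rewrite (@hmulcE _ _ _ r) //; last first.
  by move=> a sa tua; apply/rP; split => //; apply: hmulc_neq0.
rewrite -[RHS]/((hmul (hmul s t) u) q) (hmulC (hmul s t) u) /= (@hmulcE _ _ _ r') //; last first.
  by move=> c uc stc; apply/rP'; split => //; apply: hmulc_neq0.
transitivity (\sum_(a <- r) \sum_(c <- r') s a * (u c * t (q - a - c))).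
  rewrite !big_seq; apply: eq_bigr => a ar; rewrite -mulr_sumr; congr (_ * _).
  rewrite -[LHS]/((hmul t u) (q - a)) (hmulC t u) /= (@hmulcE _ _ _ r') //.
  move=> c uc tc; apply/rP'; split => //; exists a; last by rewrite /supp /= addrAC.
  by have /rP[] := ar.
rewrite exchange_big /= !big_seq; apply: eq_bigr => c cr.
rewrite (@hmulcE _ _ _ r) //.
  rewrite mulr_sumr; apply: eq_bigr => a _.
  by rewrite mulrCA addrAC.
move=> a sa tc; apply/rP; split => //; exists (q - c - a); first exact: tc.
have /rP'[uc _] := cr; rewrite (_ : q - a - (q - c - a) = c) //.
by ring.
Qed.

Lemma hone_neq0 : hconst 1 != hconst 0.
Proof.
by apply/eqP => /(congr1 (fun s => s 0)) /= /eqP; rewrite oner_eq0.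
Qed.

HB.instance Definition _ := GRing.isZmodule.Build (hahn k) haddA haddC hadd0 haddN.
HB.instance Definition _ :=
  GRing.Zmodule_isComNzRing.Build (hahn k) hmulA hmulC hmul1 hmulDl hone_neq0.

Lemma coef0 q : (0 : hahn k) q = 0. Proof. by rewrite /= if_same. Qed.
Lemma coefD s t q : (s + t) q = s q + t q. Proof. by []. Qed.
Lemma coefN s q : (- s) q = - s q. Proof. by []. Qed.
Lemma coef_sum I (r : seq I) (P : pred I) (F : I -> hahn k) q :
  (\sum_(i <- r | P i) F i) q = \sum_(i <- r | P i) F i q.
Proof. by apply: (big_morph (fun s : hahn k => s q)) => //; exact: coef0. Qed.
Lemma coefM s t q : (s * t) q = hmulc s t q. Proof. by []. Qed.

Lemma hmonoM a b (x y : k) : hmono a x * hmono b y = hmono (a + b) (x * y).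
Proof.
apply: hahn_ext => q; rewrite coefM (@hmulcE _ _ _ [:: a]) //; last first.
  by move=> c /=; rewrite inE; have [//|_] := eqVneq c a; rewrite eqxx.
rewrite big_seq1 /= eqxx subr_eq [a + b]addrC.
by case: eqP; rewrite ?mulr0.
Qed.

Definition vge s c := forall q, s q != 0 -> c <= q.

Lemma vgeM s t c d : vge s c -> vge t d -> vge (s * t) (c + d).
Proof.
move=> sc td q /hmulc_neq0[a /sc ca /td]; rewrite lerBrDl.
by apply: le_trans; rewrite lerD2r.
Qed.

Lemma vge_exp u d n : vge u d -> vge (u ^+ n) (d *+ n).
Proof.
move=> ud; elim: n => [|n IH].
  move=> q; rewrite expr0 /=; have [->|_] := eqVneq q 0; first by rewrite mulr0n.
  by rewrite eqxx.
by rewrite exprS mulrS; apply: vgeM.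
Qed.

Section Geometric.
Variables (u : hahn k) (d : rat).
Hypotheses (d0 : 0 < d) (ud : vge u d).

Let S N := \sum_(n < N) u ^+ n.
Let bd q := Num.bound (`|q| / d).

Let lt_bd q : q < d *+ bd q.
Proof.
rewrite -mulr_natl; apply: le_lt_trans (ler_norm q) _.
by rewrite -ltr_pdivrMr //; apply: archi_boundP; rewrite divr_ge0 // ltW.
Qed.

Let pow0 q N : q < d *+ N -> (u ^+ N) q = 0.
Proof.
move=> qN; have [//|/(vge_exp ud)] := eqVneq ((u ^+ N) q) 0.
by rewrite leNgt qN.
Qed.

Let S_stable q N M : q < d *+ N -> (N <= M)%N -> S M q = S N q.
Proof.
move=> qN NM; rewrite /S -!(big_mkord xpredT (fun n => u ^+ n)).
rewrite (big_cat_nat (n := N)) // [LHS]coefD [X in _ + X](_ : _ = 0) ?addr0 //.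
rewrite coef_sum big_nat big1 // => n /andP[Nn _]; apply: pow0.
by apply: (lt_le_trans qN); rewrite -subr_ge0 -mulrnBr // mulrn_wge0 // ltW.
Qed.

Let b q := S (bd q) q.

Let bE q N : q < d *+ N -> b q = S N q.
Proof.
move=> qN; have [le|/ltnW le] := leqP N (bd q); first exact: S_stable.
by rewrite /b -(S_stable (lt_bd q) le).
Qed.

Let b_wo : well_ordered [set q | b q != 0].
Proof.
move=> B Bb [x Bx]; have [m [Bm mx] lm] : exists2 m, (B `&` [set y | y <= x]) m &
    lbound (B `&` [set y | y <= x]) m.
  apply: (suppP (S (bd x))); last by exists x; split => /=.
  move=> y [By yx]; have := Bb _ By; rewrite /= (@bE _ (bd x)) //.
  exact: le_lt_trans yx (lt_bd x).
exists m => // y By; have [yx|xy] := leP y x; first exact: lm.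
exact: le_trans mx (ltW xy).
Qed.

Lemma geometric : exists t, (1 - u) * t = 1.
Proof.
exists (Hahn b_wo); apply: hahn_ext => q.
have u1 : vge (1 - u) 0.
  move=> a; apply: contra_neqT; rewrite -ltNge => a0; rewrite coefD coefN.
  rewrite [X in _ - X](_ : _ = 0) ?subr0 /=; last first.
    have [//|/ud] := eqVneq (u a) 0.
    by rewrite leNgt (lt_trans a0 d0).
  by rewrite lt_eqF.
have [r [ur rP]] : exists r : seq rat, uniq r /\ forall a,
   ([set a | supp (1 - u) a /\ supp (Hahn b_wo) (q - a)] `|`
    [set a | supp (1 - u) a /\ supp (S (bd q)) (q - a)]) a <-> a \in r.
  by apply: finite_seq; rewrite finite_setU; split; apply: finite_pairs; exact: suppP.
transitivity (((1 - u) * S (bd q)) q).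
  rewrite !coefM !(@hmulcE _ _ _ r) //.
  - apply: eq_bigr => a _; have [->|/u1 a0] := eqVneq ((1 - u) a) 0.
      by rewrite !mul0r.
    congr (_ * _); rewrite /= (@bE _ (bd q)) //.
    by apply: le_lt_trans (lt_bd q); rewrite gerBl.
  - by move=> a sa ta; apply/rP; right.
  - by move=> a sa ta; apply/rP; left.
rewrite /S -opprB mulNr -subrX1 opprB coefD coefN pow0 ?subr0 //.
Qed.
End Geometric.

Lemma hinv_exists s : s != 0 -> exists t, t * s = 1.
Proof.
move=> s0; have [m sm lm] : exists2 m, supp s m & lbound (supp s) m.
  apply: (suppP s) => //; apply/set0P; apply: contra_neq s0 => s0.
  apply: hahn_ext => q; rewrite coef0; apply: contrapT => /eqP sq.
  by have : supp s q by []; rewrite s0.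
pose u := 1 - hmono (- m) (s m)^-1 * s.
have uE q : u q = (q == 0)%:R - (s m)^-1 * s (q + m).
  rewrite /u coefD coefN coefM (@hmulcE _ _ _ [:: - m]) //; last first.
    by move=> c /=; rewrite inE; have [//|_] := eqVneq c (- m); rewrite eqxx.
  by rewrite big_seq1 /= eqxx opprK; case: eqP.
have u_gt0 q : u q != 0 -> 0 < q.
  rewrite uE; apply: contra_neqT; rewrite -leNgt le_eqVlt => /orP[/eqP ->|q0].
    by rewrite eqxx add0r mulVf ?subrr.
  rewrite lt_eqF // sub0r (_ : s (q + m) = 0) ?mulr0 ?oppr0 //.
  have [//|sq] := eqVneq (s (q + m)) 0.
  have : m <= q + m by exact: lm.
  by rewrite lerDr leNgt q0.
have [t ut] : exists t, (1 - u) * t = 1.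
  have [u0|/set0P un0] := eqVneq (supp u) set0.
    apply: (@geometric u 1) => // q uq.
    by have : supp u q by []; rewrite u0.
  have [d ud ld] := suppP u _ (@subset_refl _ _) un0.
  by apply: (@geometric u d) => //; apply: u_gt0.
exists (t * hmono (- m) (s m)^-1); rewrite -mulrA.
by move: ut; rewrite mulrC /u subKr.
Qed.

Definition hinv s : hahn k := if s == 0 then 0 else xget 0 [set t | t * s = 1].

Lemma hmulV s : s != 0 -> hinv s * s = 1.
Proof.
move=> s0; rewrite /hinv (negPf s0); case: xgetP => [t _ //|].
by have [t ts] := hinv_exists s0 => /(_ t).
Qed.

Lemma hinv0 : hinv 0 = 0. Proof. by rewrite /hinv eqxx. Qed.

HB.instance Definition _ := GRing.ComNzRing_isField.Build (hahn k) hmulV hinv0.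

End HahnRing.

Arguments suppP {k} s.

Section Subfields.
Variable F : fieldType.
Implicit Types (K L A : set F) (b : F).

Definition subfield K : Prop := GRing.divring_closed [in K].

Definition adjoin K A : set F := smallest subfield (K `|` A).

Definition compositum (I : Type) (E : I -> set F) : set F :=
  smallest subfield (\bigcup_i E i).

Definition alg_closure K : set F :=
  [set b | exists p : {poly F},
     [/\ p \is a polyOver [in K], p != 0 & root p b]].

(* m is the degree of the minimal polynomial of b over K *)
Definition elt_degree K b (m : nat) : Prop :=
  exists p : {poly F},
    [/\ p \is a polyOver [in K], p \is monic, root p b, size p = m.+1 &
        forall q : {poly F}, q \is a polyOver [in K] -> q != 0 -> root q b ->
          (size p <= size q)%N].

Definition ext_degree K L (m : nat) : Prop :=
  exists e : 'I_m -> F,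
    [/\ forall i, L (e i),
        forall c : 'I_m -> F, (forall i, K (c i)) ->
          \sum_i c i * e i = 0 -> forall i, c i = 0 &
        forall x, L x ->
          exists2 c : 'I_m -> F, forall i, K (c i) & x = \sum_i c i * e i].

Definition linearly_disjoint K (n : nat) (alpha : 'I_n -> F) : Prop :=
  exists (N : nat) (d : 'I_n -> nat),
    [/\ ext_degree K (adjoin K (range alpha)) N,
        forall i, ext_degree K (adjoin K [set alpha i]) (d i) &
        N = (\prod_i d i)%N].

(* surjectivity of Frobenius; this is perfectness when p is the characteristic *)
Definition perfect_char (p : nat) K : Prop :=
  forall a, K a -> exists2 b, K b & b ^+ p = a.

Definition artin_schreier (p : nat) K alpha : Prop :=
  [/\ alg_closure K alpha, K (alpha ^+ p - alpha) &
      forall c, K c -> alpha ^+ p - alpha != c ^+ p - c].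

End Subfields.

Section HahnValuation.
Variable k : fieldType.
Implicit Types (K L : set (hahn k)) (s a b theta : hahn k).

(* -oo is never a value; the support of s <> 0 has a least element (suppP) *)
Definition hval s : \bar rat :=
  if s == 0 then +oo%E
  else (xget 0 [set m | supp s m /\ lbound (supp s) m])%:E.

(* the subfield k(y) *)
Definition ratfun : set (hahn k) :=
  smallest (@subfield (hahn k)) (range (@hconst k) `|` [set hvar k]).

Definition val_ring K : set (hahn k) := [set a | K a /\ (0 <= hval a)%E].

Definition henselian K : Prop :=
  forall (f : {poly hahn k}) a,
    f \is a polyOver [in val_ring K] -> f \is monic -> val_ring K a ->
    (0 < hval f.[a])%E -> hval f^`().[a] = 0%E ->
    exists b, [/\ val_ring K b, root f b & (0 < hval (b - a)%R)%E].

Definition no_finite_limits (R : realType) K : Prop :=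
  forall a, K a -> limit_point ((ratr : rat -> R) @` supp a) = set0.

Definition approx_values K theta (m : nat) : set (\bar rat) :=
  [set hval (theta - b) | b in [set b | alg_closure K b /\ elt_degree K b m]].

Definition is_min (A : set nat) (m : nat) : Prop :=
  A m /\ forall i, A i -> (m <= i)%N.

Definition depth_jump K theta (n l : nat) : set nat :=
  [set m | (l < m <= n)%N /\
     exists2 eps, approx_values K theta m eps &
       forall x, approx_values K theta l x -> (x < eps)%E].

(* The common length of the Mac Lane-Vaquie chains of f |-> v(f(theta)).
   The sequence d is determined by theta up to rank r: approx_values K theta n
   contains +oo, so a jump exists as long as d l < n. *)
Definition elt_depth K theta (r : nat) : Prop :=
  exists (n : nat) (d : nat -> nat),
    [/\ elt_degree K theta n, d 0%N = 1%N, d r = n &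
        forall l, (l < r)%N -> is_min (depth_jump K theta n (d l)) (d l.+1)].

Definition ext_depth K L (r : nat) : Prop :=
  is_min [set i | exists theta,
    [/\ alg_closure K theta, L = adjoin K [set theta] & elt_depth K theta i]] r.

End HahnValuation.

Arguments ratfun : clear implicits.

(* Main.v *)
(** With wp(z) = z^p - z, take theta = sum_i x^i alpha_i, where x in k is
    chosen so that the p^n sums sum_i x^i t_i (0 <= t_i < p) are distinct.
    These sums are the differences between theta and its conjugates, so theta
    generates L and has degree p^n.  As K is perfect, the roots
    r = (wp alpha)^(1/p^j) lie in K; subtracting the first j of them from alpha
    leaves an element whose image under wp is the last one, so theta is
    approximated from K to every value below 0.  Hence an element b that beats
    all elements of K satisfies v(theta - b) >= 0, and after translating b by a
    constant, w = theta - b has positive value.  An additive polynomial A over k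
    with A(x^i) = 0 for all i gives A(theta) in K, so A(w) lies in K(b); solving
    A(w) = z by iteration puts w, hence theta, in the completion of K(b), which
    is a vector space of dimension at most deg b over the completion K^ of K.
    By Hensel's lemma elements of K of nonnegative value are in wp(K), so the
    alpha_i stay independent modulo K^, theta still has degree p^n over K^, and
    p^n <= deg b. *)

Require Import Defs.
From HB Require Import structures.
From mathcomp Require Import all_boot all_order all_algebra.
From mathcomp Require Import all_classical.
From mathcomp Require Import ring.
From mathcomp Require Import reals constructive_ereal topology normedtype.
Set Implicit Arguments.
Unset Strict Implicit.
Unset Printing Implicit Defensive.
Import Order.TTheory GRing.Theory Num.Theory.
Import numFieldNormedType.Exports.
Local Open Scope classical_set_scope.
Local Open Scope ring_scope.

(** * Subfields given as sets, viewed as field types *)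

Section SubfieldType.
Variables (F : fieldType) (E : set F) (hE : subfield E).

(** The closure proof is an argument so that the instance below can be attached to the predicate. *)
Definition subfield_pred of subfield E : {pred F} := [in E].
HB.instance Definition _ :=
  GRing.isDivringClosed.Build F (subfield_pred hE) hE.

Definition subfield_carrier := {x | x \in subfield_pred hE}.
HB.instance Definition _ := SubType.on subfield_carrier.
HB.instance Definition _ := Choice.on subfield_carrier.
HB.instance Definition _ :=
  [SubChoice_isSubComUnitRing of subfield_carrier by <:].
HB.instance Definition _ :=
  [SubComUnitRing_isSubIntegralDomain of subfield_carrier by <:].
HB.instance Definition _ :=
  [SubIntegralDomain_isSubField of subfield_carrier by <:].

Lemma mem_subfield x : E x <-> x \in subfield_pred hE.
Proof. by split=> [/mem_set|/set_mem]. Qed.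

(* Opaque on purpose: unification should never unfold the carrier. *)
Lemma subfield_as_type :
  {T : fieldType & {f : {rmorphism T -> F} | forall x, E x <-> exists y, f y = x}}.
Proof.
exists subfield_carrier, (val : {rmorphism subfield_carrier -> F}) => x.
split=> [/mem_subfield Ex|[y <-]]; first by exists (Sub x Ex).
by apply/mem_subfield; exact: (valP y).
Qed.

Definition subfield_type : fieldType := projT1 subfield_as_type.
Definition sfval : {rmorphism subfield_type -> F} :=
  sval (projT2 subfield_as_type).

Lemma sfval_in x : E (sfval x).
Proof. by apply/(svalP (projT2 subfield_as_type)); exists x. Qed.

Lemma sfval_onto x : E x -> exists y, sfval y = x.
Proof. by move/(svalP (projT2 subfield_as_type)). Qed.

End SubfieldType.

(** * Minimal polynomials *)

Section MinimalPolynomial.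
Variables (T F : fieldType) (f : {rmorphism T -> F}) (a : F).

(** A nonzero polynomial of least size vanishing at [a] is taken and made monic; a nonzero remainder
    modulo it would be smaller still. *)
Lemma ex_minpoly (P : {poly T}) : P != 0 -> root (map_poly f P) a ->
  exists2 q, q \is monic &
    forall Q : {poly T}, root (map_poly f Q) a = (q %| Q).
Proof.
move=> P0 Pa.
pose D := fun m : nat =>
  `[< exists Q : {poly T}, [/\ Q != 0, root (map_poly f Q) a & size Q = m] >].
have exD : exists m, D m by exists (size P); apply/asboolP; exists P.
case: (ex_minnP exD) => m /asboolP[Q [Q0 Qa Qm]] minm.
exists ((lead_coef Q)^-1 *: Q).
  by rewrite monicE lead_coefZ mulVf // lead_coef_eq0.
move=> A; rewrite dvdpZl ?invr_eq0 ?lead_coef_eq0 //.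
apply/idP/idP => [Aa|/dvdpP[B ->]]; last first.
  by rewrite rmorphM rootM Qa orbT.
rewrite /dvdp; apply: contraT => R0.
have Ra : root (map_poly f (A %% Q)) a.
  rewrite -(addKr (A %/ Q * Q) (A %% Q)) -divp_eq rmorphD rmorphN rmorphM /=.
  rewrite /root hornerD hornerN hornerM.
  by rewrite (eqP Qa) (eqP Aa) mulr0 oppr0 addr0.
have : D (size (A %% Q)) by apply/asboolP; exists (A %% Q).
by move/minm; rewrite leqNgt -Qm ltn_modp Q0.
Qed.

End MinimalPolynomial.

(** * The polynomial [X^p - X - b] and its irreducibility *)

Section ArtinSchreierPolynomial.
Variables (p : nat) (F : fieldType).
Hypothesis hp : p \in [pchar F].

Lemma pchar_natr_inj s t : (s < p)%N -> (t < p)%N -> s%:R = t%:R :> F -> s = t.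
Proof.
wlog st : s t / (s <= t)%N.
  move=> W sp tp e; have [le|/ltnW le] := leqP s t; first exact: W.
  by apply/esym/W.
move=> sp tp /esym/eqP; rewrite -subr_eq0 -natrB // -(dvdn_pcharf hp).
move=> /dvdnP[[|m] e]; first by apply/eqP; rewrite eqn_leq st -subn_eq0 e.
by have := leq_subr s t; rewrite leqNgt e mulSn (leq_trans tp) ?leq_addr.
Qed.

Lemma artin_schreier_size (b : F) : size ('X^p - 'X - b%:P) = p.+1.
Proof.
have p1 := prime_gt1 (pcharf_prime hp).
rewrite -addrA size_polyDl size_polyXn // ltnS.
by rewrite -opprD size_polyN size_XaddC.
Qed.

Lemma artin_schreier_monic (b : F) : 'X^p - 'X - b%:P \is monic.
Proof.
have p1 := prime_gt1 (pcharf_prime hp).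
rewrite monicE -addrA lead_coefDl ?lead_coefXn //.
by rewrite size_polyXn ltnS -opprD size_polyN size_XaddC.
Qed.

Lemma artin_schreier_root (a : F) t :
  root ('X^p - 'X - (a ^+ p - a)%:P) (a + t%:R).
Proof.
rewrite /root !hornerE -!(pFrobenius_autE hp) rmorphD rmorph_nat /=.
by rewrite opprD addrACA subrr addr0 subrr.
Qed.

(** Frobenius fixes the prime field, so the [p] translates of [a] are distinct roots of a monic
    polynomial of degree [p]. *)
Lemma artin_schreier_factor (a : F) :
  'X^p - 'X - (a ^+ p - a)%:P =
    \prod_(t <- iota 0 p) ('X - (a + t%:R)%:P).
Proof.
rewrite -(big_map (fun t => a + t%:R) xpredT (fun x => 'X - x%:P)).
rewrite {1}[LHS](@all_roots_prod_XsubC _ _ [seq a + t%:R | t <- iota 0 p]).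
- by rewrite (monicP (artin_schreier_monic _)) scale1r.
- by rewrite artin_schreier_size size_map size_iota.
- by apply/allP => _ /mapP[t _ ->]; exact: artin_schreier_root.
rewrite uniq_rootsE map_inj_in_uniq ?iota_uniq // => s t.
by rewrite !mem_iota /= => sp tp /addrI; apply: pchar_natr_inj.
Qed.

(** This is the factorization at [a = 0], evaluated at [x]. *)
Lemma pchar_fixed_nat (x : F) : x ^+ p = x -> exists t : nat, x = t%:R.
Proof.
move=> xp; have := artin_schreier_factor 0.
have p0 : p != 0%N by rewrite -lt0n prime_gt0 // (pcharf_prime hp).
move/(congr1 (fun P => P.[x])); rewrite horner_prod !hornerE xp subrr.
rewrite expr0n (negPf p0) subrr subr0 => /esym/eqP.
rewrite prodf_seq_eq0 => /hasP[t _ /=].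
by rewrite !hornerE subr_eq0 => /eqP ->; exists t.
Qed.

Variables (T : fieldType) (f : {rmorphism T -> F}) (a : F) (b : T).
Hypotheses (fb : f b = a ^+ p - a) (aNf : forall x, f x != a).

(* A factor of degree d < p of X^p - X - b would have (up to the image of the
   prime field) d * a as its subleading coefficient. *)
Lemma artin_schreier_min_size (P : {poly T}) :
  root (map_poly f P) a -> P != 0 -> (p < size P)%N.
Proof.
move=> Pa P0; have [q qm qP] := ex_minpoly P0 Pa.
have q0 : q != 0 by exact: monic_neq0.
suff : (p < size q)%N by move/leq_trans; apply; rewrite dvdp_leq // -qP.
have qa : root (map_poly f q) a by rewrite qP dvdpp.
have fG : map_poly f ('X^p - 'X - b%:P) =
    \prod_(t <- iota 0 p) ('X - (a + t%:R)%:P).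
  by rewrite !rmorphB /= map_polyXn map_polyX map_polyC /= fb artin_schreier_factor.
have : q %| 'X^p - 'X - b%:P.
  rewrite -qP !rmorphB /= map_polyXn map_polyX map_polyC /= fb.
  by have := artin_schreier_root a 0; rewrite mulr0n addr0.
rewrite -(dvdp_map f) fG => /dvdp_prod_XsubC[m]; rewrite eqp_monic ?monic_map ?monic_prod_XsubC //.
set s := mask _ _; move/eqP.
rewrite -(big_map (fun t => a + t%:R) xpredT (fun x => 'X - x%:P)) => eq.
rewrite -(size_map_poly f) eq size_prod_XsubC size_map ltnS leqNgt.
apply/negP => sp.
have s0 : size s != 0%N.
  apply/eqP => /size0nil s0; move: qa.
  by rewrite eq s0 big_nil /root hornerC oner_eq0.
have := @coefPn_prod_XsubC F [seq a + t%:R | t <- s].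
rewrite -eq coef_map size_map => /(_ s0)/esym; rewrite big_map big_split /=.
rewrite big_const_seq count_predT iter_addr_0 -natr_sum => e.
have sF : (size s)%:R != 0 :> F.
  by rewrite -(dvdn_pcharf hp) gtnNdvd // lt0n.
have := aNf ((- q`_(size s).-1 - (\sum_(i <- s) i)%:R) / (size s)%:R).
rewrite fmorph_div rmorphB rmorphN -e !rmorph_nat opprK addrK.
by rewrite -(mulr_natr a) mulfK // eqxx.
Qed.

(** The remainder of [P] modulo [X^p - X - b] vanishes at [a] and has size at most [p], so it is
    zero by [artin_schreier_min_size]; hence [P] vanishes at every root of [X^p - X - b]. *)
Lemma artin_schreier_translate (P : {poly T}) t :
  root (map_poly f P) a -> root (map_poly f P) (a + t%:R).
Proof.
have fG : map_poly f ('X^p - 'X - b%:P) = 'X^p - 'X - (a ^+ p - a)%:P.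
  by rewrite -fb !rmorphB /= map_polyXn map_polyX map_polyC.
set G := 'X^p - 'X - b%:P in fG.
have sG : size G = p.+1.
  by rewrite -(size_map_poly f) fG artin_schreier_size.
have G0 : G != 0 by rewrite -size_poly_eq0 sG.
have Ga s : root (map_poly f G) (a + s%:R).
  by rewrite fG artin_schreier_root.
move=> Pa; have : root (map_poly f (P %% G)) a.
  rewrite -(addKr (P %/ G * G) (P %% G)) -divp_eq rmorphD rmorphN rmorphM /=.
  rewrite /root hornerD hornerN hornerM.
  have := Ga 0; rewrite mulr0n addr0 => /eqP ->.
  by rewrite (eqP Pa) mulr0 oppr0 addr0.
have [R0 _|R0 /artin_schreier_min_size/(_ R0)] := eqVneq (P %% G) 0.
  by rewrite (divp_eq P G) R0 addr0 rmorphM rootM Ga orbT.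
by rewrite ltnNge -ltnS -sG ltn_modp G0.
Qed.

End ArtinSchreierPolynomial.

(** * Artin-Schreier elements of a simple Artin-Schreier extension *)

Section ArtinSchreierLinear.
Variables (p : nat) (F T : fieldType) (f : {rmorphism T -> F}) (a : F) (b : T).
Hypotheses (hp : p \in [pchar F]) (fb : f b = a ^+ p - a).
Hypothesis aNf : forall x, f x != a.

(* If s = P(a+1) - P(a), then P and s X differ by a constant since both
   have degree < p and the difference takes the same value at all a + t. *)
Lemma artin_schreier_linear (P : {poly T}) c :
  let beta := (map_poly f P).[a] in
  f c = beta ^+ p - beta -> exists s x, f x = beta - a *+ s.
Proof.
move=> beta; rewrite {}/beta.
have p1 := prime_gt1 (pcharf_prime hp).
wlog sP : P / (size P <= p)%N => [W|].
  have G0 : 'X^p - 'X - b%:P != 0.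
    rewrite -(map_poly_eq0 f) !rmorphB /= map_polyXn map_polyX map_polyC /= fb.
    by rewrite -size_poly_eq0 artin_schreier_size.
  have sG : size ('X^p - 'X - b%:P) = p.+1.
    rewrite -(size_map_poly f) !rmorphB /= map_polyXn map_polyX map_polyC /= fb.
    by rewrite artin_schreier_size.
  have := W (P %% ('X^p - 'X - b%:P)); rewrite -ltnS -sG ltn_modp G0.
  suff -> : (map_poly f (P %% ('X^p - 'X - b%:P))).[a] = (map_poly f P).[a].
    by apply.
  rewrite [in RHS](divp_eq P ('X^p - 'X - b%:P)) rmorphD rmorphM /= hornerD hornerM.
  rewrite [X in _ * X](_ : _ = 0) ?mulr0 ?add0r //.
  rewrite !rmorphB /= map_polyXn map_polyX map_polyC /= fb.
  by have /eqP := artin_schreier_root hp a 0; rewrite mulr0n addr0.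
set Pf := map_poly f P => fc.
have Pt t : Pf.[a + t%:R] ^+ p - Pf.[a + t%:R] = f c.
  apply/eqP; rewrite -subr_eq0; apply/eqP.
  (* Being a root of [P ^+ p - P - c] passes from [a] to its conjugates [a + t]. *)
  have /(artin_schreier_translate hp fb aNf t) : root (map_poly f (P ^+ p - P - c%:P)) a.
    rewrite !rmorphB /= rmorphXn /= map_polyC /root !hornerE.
    by rewrite -/Pf -fc subrr.
  by rewrite !rmorphB /= rmorphXn /= map_polyC /root !hornerE => /eqP.
have [s Ps] : exists s : nat, Pf.[a + 1] - Pf.[a] = s%:R.
  apply: (pchar_fixed_nat hp); apply/eqP; rewrite -subr_eq0.
  rewrite -!(pFrobenius_autE hp) rmorphB /= !(pFrobenius_autE hp).
  have := Pt 0; rewrite mulr0n addr0 => P0; have := Pt 1; rewrite mulr1n => P1.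
  have sub4 (A B u v e : F) : A - u = e -> B - v = e -> A - B - (u - v) = 0.
    by move=> <- h; rewrite -(subrr (A - u)) -{2}h; ring.
  by apply/eqP; apply: sub4 P1 P0.
exists s, P.[0].
(* The left side has size at most [p] and vanishes at [a], so it is zero by minimality. *)
have shift : P \Po ('X + 1%:P) - P - s%:R%:P = 0.
  apply/eqP; apply: contraTT isT => D0.
  suff : (size (P \Po ('X + 1%:P) - P - s%:R%:P)%R <= p)%N.
    rewrite leqNgt (artin_schreier_min_size hp fb aNf) //.
    rewrite !rmorphB /= map_comp_poly rmorphD /= map_polyX !map_polyC /=.
    by rewrite rmorph1 rmorph_nat /root !hornerE horner_comp !hornerE Ps subrr.
  apply: (leq_trans (size_polyD _ _)); rewrite geq_max size_polyN; apply/andP; split.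
    apply: (leq_trans (size_polyD _ _)); rewrite geq_max size_polyN sP andbT.
    by rewrite size_comp_poly2 // size_XaddC.
  by apply: leq_trans (size_polyC_leq1 _) (ltnW p1).
have step x : Pf.[x + 1] = Pf.[x] + s%:R.
  move/(congr1 (fun Q => (map_poly f Q).[x])): shift.
  rewrite !rmorphB /= map_comp_poly rmorphD /= map_polyX !map_polyC /=.
  rewrite rmorph1 rmorph_nat !hornerE horner_comp !hornerE ?rmorph0 ?horner0.
  by move/eqP; rewrite -addrA -opprD subr_eq0 => /eqP.
have Pat t : Pf.[a + t%:R] = Pf.[a] + (s * t)%:R.
  elim: t => [|t IH]; first by rewrite muln0 !mulr0n !addr0.
  by rewrite -natr1 addrA step IH mulnS addnC natrD addrA.
have Q0 : Pf - s%:R *: 'X - (Pf.[a] - a *+ s)%:P = 0.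
  apply: (@roots_geq_poly_eq0 _ _ [seq a + t%:R | t <- iota 0 p]).
  - apply/allP => _ /mapP[t _ ->]; rewrite /root !hornerE Pat mulrDr natrM.
    by rewrite mulr_natl; apply/eqP; ring.
  - rewrite map_inj_in_uniq ?iota_uniq // => t u.
    by rewrite !mem_iota /= => sp tp /addrI; apply: (pchar_natr_inj hp).
  rewrite size_map size_iota.
  apply: (leq_trans (size_polyD _ _)); rewrite geq_max size_polyN; apply/andP; split.
    apply: (leq_trans (size_polyD _ _)); rewrite geq_max size_polyN size_map_poly sP /=.
    by apply: leq_trans (size_scale_leq _ _) _; rewrite size_polyX.
  by apply: leq_trans (size_polyC_leq1 _) (ltnW p1).
move/(congr1 (fun Q => Q.[0])): Q0.
rewrite !hornerE ?mulr0 ?subr0 => /eqP; rewrite subr_eq0 => /eqP <-.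
by rewrite -(rmorph0 f) /Pf horner_map.
Qed.

End ArtinSchreierLinear.

(** * Adjoining elements to a subfield *)

Section Subfields.
Variable F : fieldType.
Implicit Types (E A : set F) (a x y : F).

Lemma polyOver_subfield E (hE : subfield E) (P : {poly F}) :
  P \is a polyOver [in E] <-> forall i, E P`_i.
Proof.
split=> [EP i|EP].
  by apply/(mem_subfield hE); move/(@polyOverP _ (subfield_pred hE)): EP; apply.
apply/(@polyOverP _ (subfield_pred hE)) => i.
exact/(mem_subfield hE).
Qed.

Lemma polyOver_lift E (hE : subfield E) (P : {poly F}) :
  P \is a polyOver [in E] -> exists Q, map_poly (sfval hE) Q = P.
Proof.
move=> /(polyOver_subfield hE) EP.
have [g gP] := boolp.choice (fun i => sfval_onto hE (EP i)).
exists (\poly_(i < size P) g i); apply/polyP => i.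
rewrite coef_map coef_poly; case: ltnP => [_|si]; first exact: gP.
by rewrite raddf0 nth_default.
Qed.

Lemma map_sfval_over E (hE : subfield E) (Q : {poly subfield_type hE}) :
  map_poly (sfval hE) Q \is a polyOver [in E].
Proof. by apply/(polyOver_subfield hE) => i; rewrite coef_map; exact: sfval_in. Qed.

Lemma subfield_smallest A : subfield (smallest (@subfield F) A).
Proof.
split=> [|x y /set_mem Ax /set_mem Ay|x y /set_mem Ax /set_mem Ay];
  apply/mem_set => E [hE AE]; have [E1 EB EV] := hE.
- exact: set_mem.
- by apply/set_mem/EB; apply/mem_set; [apply: Ax|apply: Ay].
- by apply/set_mem/EV; apply/mem_set; [apply: Ax|apply: Ay].
Qed.

Lemma subfield_adjoin E A : subfield (adjoin E A).
Proof. exact: subfield_smallest. Qed.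

Lemma adjoin_base E A : E `<=` adjoin E A.
Proof. by move=> x Ex D [_]; apply; left. Qed.

Lemma adjoin_gen E A : A `<=` adjoin E A.
Proof. by move=> x Ex D [_]; apply; right. Qed.

Lemma adjoin_min E A D : subfield D -> E `<=` D -> A `<=` D -> adjoin E A `<=` D.
Proof. by move=> hD ED AD x; apply; split => // y [/ED|/AD]. Qed.

(** The values [P.[a]] already form a field: if [P.[a]] is nonzero, then [P] is coprime to the
    minimal polynomial [q], and Bezout's identity evaluated at [a] inverts it. *)
Lemma adjoin_algebraic E (hE : subfield E) a (P0 : {poly F}) :
  P0 \is a polyOver [in E] -> P0 != 0 -> root P0 a ->
  adjoin E [set a] `<=`
    [set x | exists2 P : {poly F}, P \is a polyOver [in E] & x = P.[a]].
Proof.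
move=> /(polyOver_lift hE)[Q0 <-]; rewrite map_poly_eq0 => Q00 Q0a.
have [q qm qP] := ex_minpoly Q00 Q0a.
have q0 : q != 0 by exact: monic_neq0.
pose W := [set x | exists P, x = (map_poly (sfval hE) P).[a]].
suff : adjoin E [set a] `<=` W.
  by move=> + x Ex => /(_ x Ex)[P ->]; exists (map_poly (sfval hE) P) => //; exact: map_sfval_over.
have WM x y : W x -> W y -> W (x * y).
  by move=> [P ->] [Q ->]; exists (P * Q); rewrite rmorphM hornerM.
apply: adjoin_min; last first.
- by move=> _ ->; exists 'X; rewrite map_polyX hornerX.
- by move=> x /(sfval_onto hE)[y <-]; exists y%:P; rewrite map_polyC hornerC.
split=> [|x y /set_mem Wx /set_mem Wy|x y /set_mem Wx /set_mem Wy]; apply/mem_set.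
- by exists 1; rewrite rmorph1 hornerC.
- by have [[P ->] [Q ->]] := (Wx, Wy); exists (P - Q); rewrite rmorphB hornerD hornerN.
apply: WM => //; have [P ->] := Wy.
have [->|Pa] := eqVneq (map_poly (sfval hE) P).[a] 0.
  by rewrite invr0; exists 0; rewrite rmorph0 horner0.
(* Write [q = h * g] with [g] the gcd. If [g] vanished at [a], so would [P]; hence [h] does, and [q]
   dividing [h] forces [g] to be constant. *)
have : coprimep P q.
  rewrite /coprimep; set g := gcdp P q.
  have /dvdpP[h qE] : g %| q by exact: dvdp_gcdr.
  have : root (map_poly (sfval hE) q) a by rewrite qP dvdpp.
  rewrite qE rmorphM rootM !qP => /orP[qh|qg]; last first.
    by case/negP: Pa; rewrite -/(root _ _) qP (dvdp_trans qg) // dvdp_gcdl.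
  have h0 : h != 0 by apply: contra_neq q0; rewrite qE => ->; rewrite mul0r.
  have g0 : g != 0 by apply: contra_neq q0; rewrite qE => ->; rewrite mulr0.
  move/dvdp_leq: qh => /(_ h0).
  rewrite {1}qE size_mul // -subn1 leq_subLR addnC leq_add2r => g1.
  by rewrite eqn_leq g1 size_poly_gt0.
move/Bezout_coprimepP => [[u v] /=]; rewrite -size_poly_eq1 => /size_poly1P[c c0 uv].
exists (c^-1 *: u).
rewrite map_polyZ hornerZ; apply: (mulIf Pa); rewrite mulVf //.
move/(congr1 (fun Q => (map_poly (sfval hE) Q).[a])): uv.
have /eqP qa : root (map_poly (sfval hE) q) a by rewrite qP dvdpp.
rewrite rmorphD !rmorphM /= !hornerE qa mulr0 addr0 map_polyC hornerC -mulrA => ->.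
by rewrite -rmorphM mulVf // rmorph1.
Qed.

Lemma adjoin_root_poly E (hE : subfield E) a m (G : {poly F}) :
  G \is a polyOver [in E] -> size G = m.+1 -> root G a ->
  adjoin E [set a] `<=` [set x | exists P : {poly F},
    [/\ P \is a polyOver [in E], (size P <= m)%N & x = P.[a]]].
Proof.
move=> EG sG Ga x; have G0 : G != 0 by rewrite -size_poly_eq0 sG.
move=> /(adjoin_algebraic hE EG G0 Ga)[_ /(polyOver_lift hE)[Q <-] ->].
have [H HG] := polyOver_lift hE EG; rewrite -HG in G0 sG Ga.
exists (map_poly (sfval hE) (Q %% H)); split; first exact: map_sfval_over.
  rewrite size_map_poly -ltnS -sG size_map_poly ltn_modp.
  by rewrite map_poly_eq0 in G0.
rewrite {1}(divp_eq Q H) rmorphD rmorphM /= hornerD hornerM.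
by rewrite (eqP Ga) mulr0 add0r.
Qed.

Variable p : nat.
Hypothesis hp : p \in [pchar F].

Lemma wp_sub x y : (x - y) ^+ p - (x - y) = (x ^+ p - x) - (y ^+ p - y).
Proof. by rewrite -!(pFrobenius_autE hp) rmorphB /=; ring. Qed.

Lemma wp_mulrn x m : (x *+ m) ^+ p - x *+ m = (x ^+ p - x) *+ m.
Proof. by rewrite -!(pFrobenius_autE hp) rmorphMn /= mulrnBl. Qed.

Lemma wp_sum I (r : seq I) (f : I -> F) :
  (\sum_(i <- r) f i) ^+ p - \sum_(i <- r) f i = \sum_(i <- r) (f i ^+ p - f i).
Proof. by rewrite -!(pFrobenius_autE hp) rmorph_sum sumrB. Qed.

Lemma subfield_translate E (hE : subfield E) a (P : {poly F}) t :
  E (a ^+ p - a) -> ~ E a -> P \is a polyOver [in E] ->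
  root P a -> root P (a + t%:R).
Proof.
move=> /(sfval_onto hE)[b fb] aE /(polyOver_lift hE)[Q <-].
apply: (artin_schreier_translate hp fb).
by move=> x; apply/eqP => xa; apply: aE; rewrite -xa; exact: sfval_in.
Qed.

Lemma subfield_min_size E (hE : subfield E) a (P : {poly F}) :
  E (a ^+ p - a) -> ~ E a -> P \is a polyOver [in E] ->
  root P a -> P != 0 -> (p < size P)%N.
Proof.
move=> /(sfval_onto hE)[b fb] aE /(polyOver_lift hE)[Q <-] Qa.
rewrite map_poly_eq0 size_map_poly; apply: (artin_schreier_min_size hp fb) => //.
by move=> x; apply/eqP => xa; apply: aE; rewrite -xa; exact: sfval_in.
Qed.

Lemma artin_schreier_polyOver E (hE : subfield E) a :
  E (a ^+ p - a) -> 'X^p - 'X - (a ^+ p - a)%:P \is a polyOver [in E].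
Proof.
move=> /(mem_subfield hE) Ea.
suff : 'X^p - 'X - (a ^+ p - a)%:P \is a polyOver (subfield_pred hE) by [].
by rewrite !rpredB ?polyOverC ?polyOverXn ?polyOverX.
Qed.

Lemma adjoin_artin_schreier E (hE : subfield E) a : E (a ^+ p - a) ->
  adjoin E [set a] `<=` [set x | exists P : {poly F},
    [/\ P \is a polyOver [in E], (size P <= p)%N & x = P.[a]]].
Proof.
move=> Ea; apply: (adjoin_root_poly hE (artin_schreier_polyOver hE Ea)).
  exact: artin_schreier_size.
by have := artin_schreier_root hp a 0; rewrite mulr0n addr0.
Qed.

(** This moves [artin_schreier_linear] to subfields of [F]. If [a] lies in [E], nothing is adjoined
    and [s = 0] serves. *)
Lemma subfield_linear E (hE : subfield E) a x :
  E (a ^+ p - a) -> E (x ^+ p - x) -> adjoin E [set a] x ->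
  exists s, E (x - a *+ s).
Proof.
move=> Ea Ex; have [aE|aE] := pselect (E a).
  move=> /(adjoin_min hE (@subset_refl _ E)) H.
  by exists 0%N; rewrite mulr0n subr0; apply: H => y ->.
move=> /(adjoin_artin_schreier hE Ea)[_ [/(polyOver_lift hE)[Q <-] _ xE]].
have [b fb] := sfval_onto hE Ea; have [c fc] := sfval_onto hE Ex.
have aNf z : sfval hE z != a.
  by apply/eqP => za; apply: aE; rewrite -za; exact: sfval_in.
have := artin_schreier_linear hp fb aNf (P := Q) (c := c).
rewrite -xE => /(_ fc)[s [y yE]]; exists s; rewrite -yE; exact: sfval_in.
Qed.

(** Elements are adjoined one at a time, so that each step is a simple extension and induction on
    the list applies. *)
Definition adjoin_list E s := foldl (fun D a => adjoin D [set a]) E s.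

Lemma subfield_adjoin_list E s : subfield E -> subfield (adjoin_list E s).
Proof. by elim: s E => [|a s IH] E //= hE; apply/IH/subfield_adjoin. Qed.

Lemma adjoin_list_base E s : E `<=` adjoin_list E s.
Proof.
elim: s E => [|a s IH] E /=; first exact: subset_refl.
exact: subset_trans (@adjoin_base E [set a]) (IH _).
Qed.

Lemma adjoin_list_gen E s a : a \in s -> adjoin_list E s a.
Proof.
elim: s E => [|b s IH] E //=; rewrite inE => /predU1P[->|/IH //].
by apply: adjoin_list_base; apply: adjoin_gen; exact: erefl.
Qed.

(** By induction over [E(a)], the remaining elements account for [x] up to a difference in [E(a)].
    Its image under [z^p - z] is still in [E], so [subfield_linear] removes a multiple of [a]. *)
Lemma adjoin_list_linear (I : eqType) (r : seq I) (alpha : I -> F) E x :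
  subfield E -> uniq r -> (forall i, E (alpha i ^+ p - alpha i)) ->
  E (x ^+ p - x) -> adjoin_list E (map alpha r) x ->
  exists e : I -> nat, E (x - \sum_(i <- r) alpha i *+ e i).
Proof.
elim: r E => [|a r IH] E hE /=.
  by move=> _ _ _ Ex; exists (fun=> 0%N); rewrite big_nil subr0.
move=> /andP[ar ur] Ealpha Ex xr.
have [e He] : exists e : I -> nat,
    adjoin E [set alpha a] (x - \sum_(i <- r) alpha i *+ e i).
  apply: IH => //; first exact: subfield_adjoin.
    by move=> i; apply: adjoin_base.
  exact: adjoin_base.
have [|s Es] := subfield_linear hE (Ealpha a) _ He.
  rewrite wp_sub wp_sum; apply/(mem_subfield hE)/rpredB; first exact/(mem_subfield hE).
  by apply: rpred_sum => i _; rewrite wp_mulrn rpredMn //; exact/(mem_subfield hE)/Ealpha.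
(* As [a] does not occur in [r], resetting its coefficient leaves the sum over [r] unchanged. *)
exists (fun i => if i == a then s else e i).
rewrite big_cons eqxx (_ : \sum_(j <- r) _ = \sum_(i <- r) alpha i *+ e i).
  by rewrite [_ *+ s + _]addrC opprD addrA.
by rewrite big_seq [RHS]big_seq; apply: eq_bigr => i ir; case: eqP => // ia; rewrite -ia ir in ar.
Qed.

End Subfields.

(** * Dimension bounds, and independence modulo a subfield *)

Section Spanned.
Variable F : fieldType.
Implicit Types (E D W : set F) (a x : F).

(** An upper bound for the dimension: [g] may be dependent and need not lie in [W]. Any finite index
    type is allowed, so that products of families can be indexed by pairs. *)
Definition spanned E W (s : nat) := exists (J : finType) (g : J -> F),
  #|J| = s /\ forall x, W x ->
    exists c : J -> F, (forall j, E (c j)) /\ x = \sum_j c j * g j.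

(** The coordinates of the [e i] form a matrix with more rows than columns, so its left kernel is
    nonzero. *)
Lemma spanned_dependent E (hE : subfield E) W s (I : finType) (e : I -> F) :
  spanned E W s -> (forall i, W (e i)) -> (s < #|I|)%N ->
  exists c : I -> F, [/\ forall i, E (c i), exists i, c i != 0 &
    \sum_i c i * e i = 0].
Proof.
move=> [J [g [Js gW]]] We; rewrite -Js => JI.
have [c cP] := boolp.choice (fun i => gW _ (We i)).
have [m mP] := boolp.choice (fun ij : I * J => sfval_onto hE ((cP ij.1).1 ij.2)).
pose M : 'M_(#|I|, #|J|) := \matrix_(i, j) m (enum_val i, enum_val j).
have : kermx M != 0.
  by rewrite -mxrank_eq0 mxrank_ker subn_eq0 -ltnNge (leq_ltn_trans (rank_leq_col _)).
move/rowV0Pn => [v /sub_kermxP vM v0].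
have [k vk] : exists k, v 0 k != 0.
  apply/existsP; apply: contraNT v0 => /existsPn v0.
  by apply/eqP/rowP => k; rewrite mxE; apply/eqP; move: (v0 k); rewrite negbK.
exists (fun i => sfval hE (v 0 (enum_rank i))); split.
- by move=> i; exact: sfval_in.
- by exists (enum_val k); rewrite enum_valK fmorph_eq0.
transitivity (\sum_i \sum_j sfval hE (v 0 (enum_rank i) * m (i, j)) * g j).
  apply: eq_bigr => i _; rewrite (cP i).2 mulr_sumr; apply: eq_bigr => j _.
  by rewrite rmorphM mP mulrA.
rewrite exchange_big big1 // => j _; rewrite -mulr_suml -rmorph_sum.
move/rowP: vM => /(_ (enum_rank j)); rewrite !mxE.
rewrite (reindex (@enum_rank I)) /=; last first.
  by apply: onW_bij; exact: enum_rank_bij.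
under eq_bigr => i _ do rewrite mxE !enum_rankK.
by move=> ->; rewrite rmorph0 mul0r.
Qed.

Lemma spanned_leq E (hE : subfield E) W s m (e : 'I_m -> F) :
  spanned E W s -> (forall i, W (e i)) ->
  (forall c : 'I_m -> F, (forall i, E (c i)) -> \sum_i c i * e i = 0 ->
     forall i, c i = 0) -> (m <= s)%N.
Proof.
move=> sW We indep; rewrite leqNgt; apply/negP; rewrite -{1}(card_ord m).
move=> /(spanned_dependent hE sW We)[c [Ec [i ci] c0]].
by move: ci; rewrite indep ?eqxx.
Qed.

(** The [m + 1] powers [1, a, ..., a^m] are dependent. *)
Lemma spanned_power_root E (hE : subfield E) W m a :
  spanned E W m -> (forall i, W (a ^+ i)) -> exists P : {poly F},
    [/\ P \is a polyOver [in E], P != 0, (size P <= m.+1)%N & root P a].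
Proof.
move=> sW Wa; have := spanned_dependent hE (e := fun i : 'I_m.+1 => a ^+ i) sW.
rewrite card_ord => /(_ (fun i => Wa i) (ltnSn _))[c [Ec [i ci] c0]].
pose P := \poly_(k < m.+1) c (inord k).
have PE (k : 'I_m.+1) : P`_k = c k by rewrite coef_poly ltn_ord inord_val.
exists P; split; last by rewrite /root (@horner_coef_wide _ m.+1) ?size_poly //;
  under eq_bigr => k _ do rewrite PE; rewrite c0.
- apply/(polyOver_subfield hE) => k; rewrite coef_poly; case: ifP => // _.
  exact/(mem_subfield hE)/rpred0.
- by apply: contra_neq ci => P0; rewrite -PE P0 coef0.
- exact: size_poly.
Qed.

Lemma spanned_self E : subfield E -> spanned E E 1.
Proof.
move=> hE; exists unit, (fun=> 1); split; first exact: card_unit.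
by move=> x Ex; exists (fun=> x); split=> //; rewrite big_const card_unit /= mulr1 addr0.
Qed.

Variable p : nat.
Hypothesis hp : p \in [pchar F].

Lemma spanned_adjoin E D (hD : subfield D) a s :
  D (a ^+ p - a) -> spanned E D s -> spanned E (adjoin D [set a]) (s * p).
Proof.
move=> Da [J [g [<- gD]]].
exists (J * 'I_p)%type, (fun ji : J * 'I_p => g ji.1 * a ^+ ji.2); split.
  by rewrite card_prod card_ord.
move=> x /(adjoin_artin_schreier hp hD Da)[R [/(polyOver_subfield hD) RD sR ->]].
have [c cP] := boolp.choice (fun i => gD _ (RD i)).
exists (fun ji : J * 'I_p => c ji.2 ji.1); split; first by move=> ji; exact: (cP _).1.
rewrite (@horner_coef_wide _ p) //.
rewrite -(pair_big xpredT xpredT (fun j (i : 'I_p) => c i j * (g j * a ^+ i))) /=.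
rewrite exchange_big; apply: eq_bigr => i _.
by rewrite (cP i).2 mulr_suml; apply: eq_bigr => j _; rewrite mulrA.
Qed.

Lemma spanned_adjoin_list E D (hD : subfield D) (r : seq F) s :
  (forall a, a \in r -> D (a ^+ p - a)) ->
  spanned E D s -> spanned E (adjoin_list D r) (s * p ^ size r).
Proof.
elim: r D hD s => [|a r IH] D hD s Dr sD /=; first by rewrite muln1.
rewrite expnS mulnA; apply: IH; first exact: subfield_adjoin.
  by move=> b br; apply: adjoin_base; apply: Dr; rewrite inE br orbT.
by apply: spanned_adjoin => //; apply: Dr; exact: mem_head.
Qed.

(** Linear independence over the prime field of the classes of the [alpha i] modulo [E]; natural
    numbers stand for elements of the prime field. *)
Definition as_independent E n (alpha : 'I_n -> F) := forall e : 'I_n -> nat,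
  E (\sum_i alpha i *+ e i) -> forall i, (p %| e i)%N.

(** If some [e j] were prime to [p], the others would generate [alpha j] and the compositum would
    have degree at most [p^(n-1)]; linear disjointness makes this degree a product of [n] factors,
    each at least [p]. *)
Lemma linearly_disjoint_independent K (hK : subfield K) n (alpha : 'I_n -> F) :
  (forall i, K (alpha i ^+ p - alpha i)) -> (forall i, ~ K (alpha i)) ->
  linearly_disjoint K alpha -> as_independent K alpha.
Proof.
move=> Kalpha alphaK [N [d [[b [bL bfree _]] dP NE]]] e Ke j.
apply: contraT => pj.
have n0 : (0 < n)%N by exact: leq_ltn_trans (ltn_ord j).
have p1 := prime_gt1 (pcharf_prime hp).
pose r := map alpha (enum (predC1 j)).
pose D := adjoin_list K r; have hD : subfield D by exact: subfield_adjoin_list.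
have Dneq i : i != j -> D (alpha i).
  by move=> ij; apply: adjoin_list_gen; apply: map_f; rewrite mem_enum.
have Dalpha i : D (alpha i).
  have [->|/Dneq //] := eqVneq i j; apply/(mem_subfield hD).
  have pF : (e j)%:R != 0 :> F by rewrite -(dvdn_pcharf hp).
  rewrite -(mulfK pF (alpha j)); apply: rpred_div; last exact: rpred_nat.
  rewrite mulr_natr -[X in X \in _](addrK (\sum_(i | i != j) alpha i *+ e i)).
  rewrite -(bigD1 j (P := xpredT) (F := fun i => alpha i *+ e i)) //=.
  apply: rpredB; first by apply/(mem_subfield hD)/adjoin_list_base.
  by apply: rpred_sum => k kj; apply/rpredMn/(mem_subfield hD)/Dneq.
have sD : spanned K D (1 * p ^ size r).
  apply: spanned_adjoin_list => //; last exact: spanned_self.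
  by move=> _ /mapP[i _ ->].
move: sD; rewrite mul1n size_map -cardE cardC1 card_ord => sD.
have : (N <= p ^ n.-1)%N.
  apply: (spanned_leq hK sD _ bfree) => i.
  apply: (adjoin_min hD _ _ (bL i)); first exact: adjoin_list_base.
  by move=> _ [k _ <-].
suff : (p ^ n <= N)%N.
  move=> /leq_trans H /H; rewrite leq_exp2l //.
  by rewrite leqNgt prednK // leqnn.
rewrite NE -{1}(card_ord n) -prod_nat_const; apply: leq_prod => i _.
have [g [gK gfree gspan]] := dP i.
have sK : spanned K (adjoin K [set alpha i]) (d i).
  by exists 'I_(d i), g; split; [exact: card_ord|move=> x /gspan[c Kc xc]; exists c].
have [|P [PK P0 sP Pa]] := spanned_power_root hK (a := alpha i) sK.
  move=> k; apply/(mem_subfield (subfield_adjoin K [set alpha i])); apply: rpredX.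
  by apply/(mem_subfield (subfield_adjoin K [set alpha i])); apply: adjoin_gen.
rewrite -ltnS; apply: leq_trans sP.
exact: (subfield_min_size hp hK (Kalpha i) (alphaK i)).
Qed.

End Spanned.

(** * Linear combinations of Artin-Schreier elements and their conjugates *)

Section GenericCombination.
Variables (F : fieldType) (p : nat).
Hypothesis hp : p \in [pchar F].
Implicit Types (E D W : set F) (a x : F).
Variables (E : set F) (hE : subfield E) (n : nat) (alpha : 'I_n -> F).
Hypotheses (Ealpha : forall i, E (alpha i ^+ p - alpha i))
  (alpha_indep : as_independent p E alpha).

Let others j := adjoin_list E (map alpha (enum (predC1 j))).

(** Otherwise [adjoin_list_linear] would express [alpha j] modulo [E] by the others, contradicting
    independence. *)
Lemma independent_notin_adjoin j : ~ others j (alpha j).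
Proof.
move=> /(adjoin_list_linear hp hE (enum_uniq _) Ealpha (Ealpha j))[e].
rewrite big_enum /= => Ee.
have p1 := prime_gt1 (pcharf_prime hp).
(* Coefficients are natural numbers, so [p.-1] stands for -1. *)
pose e' i := if i == j then p.-1 else e i.
have : E (\sum_i alpha i *+ e' i).
  rewrite (bigD1 j) //= /e' eqxx.
  rewrite (eq_bigr (fun i => alpha i *+ e i)); last by move=> i /negPf ->.
  have -> : alpha j *+ p.-1 = - alpha j.
    apply/eqP; rewrite -addr_eq0 -mulrSr prednK ?(ltnW p1) //.
    by rewrite -mulr_natr (pcharf0 hp) mulr0.
  by apply/(mem_subfield hE); rewrite -rpredN opprD opprK; apply/(mem_subfield hE).
move/alpha_indep => /(_ j); rewrite /e' eqxx gtnNdvd //.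
  by rewrite -ltnS prednK // ltnW.
by rewrite prednK // ltnW.
Qed.

Variable c : 'I_n -> F.
Hypothesis Ec : forall i, E (c i).

(** The [alpha i] are translated one at a time: over the field generated by the others, [alpha j]
    still has all the conjugates [alpha j + t]. *)
Lemma root_translate (P : {poly F}) (e : 'I_n -> nat) :
  P \is a polyOver [in E] -> root P (\sum_i c i * alpha i) ->
  root P (\sum_i c i * alpha i + \sum_i c i * (e i)%:R).
Proof.
move=> PE P0.
pose x m := \sum_i c i * (alpha i + (if (i < m)%N then e i else 0)%:R).
suff H m : (m <= n)%N -> root P (x m).
  rewrite -big_split /=; have := H n (leqnn _).
  by congr (root P _); apply: eq_bigr => i _; rewrite ltn_ord mulrDr.
elim: m => [|m IH] mn.
  by congr (root P _): P0; apply: eq_bigr => i _; rewrite addr0.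
pose j := Ordinal mn; have hD : subfield (others j) by exact: subfield_adjoin_list.
have ED x' : E x' -> x' \in subfield_pred hD.
  by move=> Ex; apply/(mem_subfield hD); exact: adjoin_list_base.
pose rest := \sum_(i | i != j) c i * (alpha i + (if (i < m)%N then e i else 0)%:R).
have Drest : rest \in subfield_pred hD.
  apply: rpred_sum => i ij; apply: rpredM; first exact/ED.
  apply: rpredD; last exact: rpred_nat.
  by apply/(mem_subfield hD)/adjoin_list_gen/map_f; rewrite mem_enum.
(* [Q] is [P] as a polynomial in [alpha j] alone; the other terms, already translated for [i < m],
   are constants in [others j]. *)
pose Q := P \Po (c j *: 'X + rest%:P).
have QD : Q \is a polyOver [in others j].
  suff : Q \is a polyOver (subfield_pred hD) by [].
  apply: polyOver_comp.
    by apply/polyOverP => i; apply/ED; move: i; apply/(polyOver_subfield hE).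
  by apply: rpredD; [apply: polyOverZ; [exact/ED|exact: polyOverX]|rewrite polyOverC].
have Qx y : Q.[y] = P.[c j * y + rest] by rewrite horner_comp !hornerE.
have := @subfield_translate _ _ hp _ hD (alpha j) Q (e j) _ (@independent_notin_adjoin j) QD.
rewrite /root !Qx => H.
have -> : x m.+1 = c j * (alpha j + (e j)%:R) + rest.
  rewrite /x (bigD1 j) //= ltnSn; congr (_ + _); apply: eq_bigr => i ij.
  by rewrite ltnS leq_eqVlt -[_ == _]/(i == j) (negPf ij).
apply: H; first exact: adjoin_list_base.
have := IH (ltnW mn); rewrite /root /x (bigD1 j) //= ltnn.
by rewrite addr0.
Qed.

Hypothesis c_inj : injective (fun t : {ffun 'I_n -> 'I_p} => \sum_i c i * (t i)%:R).

(** The translates of the combination provide [p^n] distinct roots of [P]. *)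
Lemma generic_combination_size (P : {poly F}) :
  P \is a polyOver [in E] -> root P (\sum_i c i * alpha i) -> P != 0 ->
  (p ^ n < size P)%N.
Proof.
move=> PE Pa P0.
pose rs := [seq \sum_i c i * alpha i + \sum_i c i * (t i)%:R |
             t : {ffun 'I_n -> 'I_p}].
have := @max_poly_roots _ P rs P0; rewrite size_map -cardE card_ffun !card_ord.
apply.
  by apply/allP => _ /mapP[t _ ->]; exact: (root_translate (fun i => t i)).
by rewrite map_inj_uniq ?enum_uniq // => t u /addrI /c_inj.
Qed.

End GenericCombination.

(** Distinct tuples are the coefficient lists of distinct polynomials, and over an algebraically
    closed field some [x] is a root of none of their finitely many differences. *)
Lemma ex_separating_power (k : closedFieldType) (p n : nat) :
  p \in [pchar k] ->
  exists x : k, injective (fun t : {ffun 'I_n -> 'I_p} => \sum_(i < n) x ^+ i * (t i)%:R).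
Proof.
move=> hp.
pose P (t : {ffun 'I_n -> 'I_p}) : {poly k} :=
  \poly_(i < n) (if insub i is Some i' then (t i')%:R else 0).
have Pt t (i : 'I_n) : (P t)`_i = (t i)%:R by rewrite coef_poly ltn_ord valK.
have Px t x : (P t).[x] = \sum_(i < n) x ^+ i * (t i)%:R.
  rewrite (@horner_coef_wide _ n) ?size_poly //.
  by apply: eq_bigr => i _; rewrite Pt mulrC.
have Pinj : injective P.
  move=> t u tu; apply/ffunP => i; apply/val_inj/(pchar_natr_inj hp (ltn_ord _) (ltn_ord _)).
  by have := Pt t i; rewrite tu Pt => /esym.
pose G := \prod_(t : {ffun 'I_n -> 'I_p}) \prod_(u | u != t) (P t - P u).
have : G != 0.
  apply/prodf_neq0 => t _; apply/prodf_neq0 => u ut.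
  by rewrite subr_eq0 (inj_eq Pinj) eq_sym.
move=> /closed_nonrootP[x]; rewrite /root horner_prod => /prodf_neq0 Gx.
exists x => t u; rewrite -!Px => tu; apply/eqP; apply: contraT => neq.
have := Gx t isT; rewrite horner_prod => /prodf_neq0/(_ u).
by rewrite eq_sym neq !hornerE tu subrr eqxx => /(_ isT).
Qed.

(** * Additive polynomials *)

Section AdditivePolynomials.
Variables (p : nat) (F : fieldType).
Hypothesis hp : p \in [pchar F].
Implicit Types (a : nat -> F) (n : nat) (x y : F) (E : set F).

Definition additive_eval a n x := \sum_(j < n.+1) a j * x ^+ (p ^ j).

Lemma frobenius_iterB x y j : (x - y) ^+ (p ^ j) = x ^+ (p ^ j) - y ^+ (p ^ j).
Proof.
elim: j => [|j IH]; first by rewrite !expr1.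
by rewrite expnSr !exprM IH -!(pFrobenius_autE hp) rmorphB.
Qed.

Lemma additive_evalB a n x y :
  additive_eval a n (x - y) = additive_eval a n x - additive_eval a n y.
Proof.
by rewrite -sumrB; apply: eq_bigr => j _; rewrite frobenius_iterB mulrBr.
Qed.

Lemma additive_eval0 a n : additive_eval a n 0 = 0.
Proof. by rewrite -{1}(subrr 0) additive_evalB subrr. Qed.

Lemma additive_eval_sum a n I (r : seq I) (f : I -> F) :
  additive_eval a n (\sum_(i <- r) f i) = \sum_(i <- r) additive_eval a n (f i).
Proof.
apply: (big_morph (additive_eval a n)) => [x y|]; last exact: additive_eval0.
by rewrite -{1}[y]opprK -[- y]sub0r !additive_evalB additive_eval0 sub0r opprK.
Qed.

(** Since [A(c) = 0], the value [A(c x) = A(c x) - A(c) x] involves [x] only through the differences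
    [x^(p^j) - x], which are sums of Frobenius powers of [x^p - x]. *)
Lemma additive_eval_mul E (hE : subfield E) a n c x :
  (forall j, E (a j)) -> E c -> E (x ^+ p - x) -> additive_eval a n c = 0 ->
  E (additive_eval a n (c * x)).
Proof.
move=> Ea Ec Ex c0.
have Exj j : x ^+ (p ^ j) - x \in subfield_pred hE.
  elim: j => [|j IH]; first by rewrite expr1 subrr rpred0.
  have := rpredX p IH; rewrite -(pFrobenius_autE hp) rmorphB /= !(pFrobenius_autE hp).
  rewrite -exprM -expnSr => H.
  rewrite -(subrKA (x ^+ p)); apply: rpredD => //; exact/(mem_subfield hE).
have -> : additive_eval a n (c * x) =
    \sum_(j < n.+1) a j * c ^+ (p ^ j) * (x ^+ (p ^ j) - x).
  transitivity (additive_eval a n (c * x) - additive_eval a n c * x).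
    by rewrite c0 mul0r subr0.
  rewrite mulr_suml -sumrB.
  by apply: eq_bigr => j _; rewrite exprMn mulrBr mulrA.
apply/(mem_subfield hE); apply: rpred_sum => j _.
by rewrite !rpredM ?rpredX //; apply/(mem_subfield hE).
Qed.

(* If A is additive then so is A^p - k A; the choice k = A(c)^(p-1) makes it
   vanish at c. *)
Lemma ex_additive_eval (c : nat -> F) n : exists a,
  [/\ a 0%N != 0, a n = 1 & forall i, (i < n)%N -> additive_eval a n (c i) = 0].
Proof.
have p0 : (0 < p)%N by rewrite prime_gt0 // (pcharf_prime hp).
elim: n => [|n [a [a0 an aP]]].
  by exists (fun=> 1); rewrite oner_eq0; split.
pose A := additive_eval a n.
(* If [A (c n)] is already 0, any multiplier works, and 1 keeps the linear coefficient nonzero. *)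
pose t := if A (c n) == 0 then 1 else A (c n) ^+ p.-1.
have t0 : t != 0.
  by rewrite /t; case: ifP => [_|/negbT h]; rewrite ?oner_eq0 ?expf_neq0.
(* Frobenius shifts the indices by one; the guard discards the arbitrary entries of [a] beyond
   [n]. *)
pose b j := (if j is j'.+1 then a j' ^+ p else 0) - t * (if (j <= n)%N then a j else 0).
have bE x : additive_eval b n.+1 x = A x ^+ p - t * A x.
  rewrite /additive_eval; under eq_bigr do rewrite mulrBl.
  rewrite sumrB; congr (_ - _).
    rewrite big_ord_recl mul0r add0r -(pFrobenius_autE hp) rmorph_sum /=.
    apply: eq_bigr => j _.
    by rewrite rmorphM /= !(pFrobenius_autE hp) -exprM -expnSr.
  rewrite big_ord_recr /= ltnn mulr0 mul0r addr0 mulr_sumr.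
  by apply: eq_bigr => j _; rewrite -ltnS ltn_ord mulrA.
exists b; split.
- by rewrite /b leq0n sub0r oppr_eq0 mulf_neq0.
- by rewrite /b ltnn an expr1n mulr0 subr0.
move=> i; rewrite ltnS leq_eqVlt bE => /predU1P[->|/aP]; last first.
  by rewrite -/A => ->; rewrite expr0n eqn0Ngt p0 mulr0 subrr.
rewrite /t; case: eqP => [->|_]; first by rewrite expr0n eqn0Ngt p0 mulr0 subrr.
by rewrite -exprSr prednK // subrr.
Qed.

Definition additive_poly a n z : {poly F} :=
  \sum_(j < n.+1) a j *: 'X^(p ^ j) - z%:P.

Lemma horner_additive_poly a n z x :
  (additive_poly a n z).[x] = additive_eval a n x - z.
Proof.
rewrite /additive_poly hornerD hornerN hornerC horner_sum.
by congr (_ - _); apply: eq_bigr => j _; rewrite !hornerE.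
Qed.

Lemma additive_poly_over E (hE : subfield E) a n z : (forall j, E (a j)) -> E z ->
  additive_poly a n z \is a polyOver [in E].
Proof.
move=> Ea Ez; suff : additive_poly a n z \is a polyOver (subfield_pred hE) by [].
apply: rpredB; last by rewrite polyOverC; exact/(mem_subfield hE).
apply: rpred_sum => j _; apply: polyOverZ; first exact/(mem_subfield hE).
exact: polyOverXn.
Qed.

Lemma additive_poly_monic a n z : a n = 1 ->
  additive_poly a n z \is monic /\ size (additive_poly a n z) = (p ^ n).+1.
Proof.
have p1 := prime_gt1 (pcharf_prime hp).
move=> an; rewrite /additive_poly big_ord_recr /= an scale1r addrAC addrC.
set P := _ - z%:P; have sP : (size P < size ('X^(p ^ n) : {poly F}))%N.
  rewrite size_polyXn ltnS; apply: (leq_trans (size_polyD _ _)).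
  rewrite geq_max size_polyN; apply/andP; split.
    apply: (leq_trans (size_sum _ _ _)); apply/bigmax_leqP => j _.
    apply: leq_trans (size_scale_leq _ _) _; rewrite size_polyXn.
    by rewrite ltn_exp2l.
  by apply: leq_trans (size_polyC_leq1 _) _; rewrite expn_gt0 ltnW.
split; first by rewrite monicE lead_coefDl // lead_coefXn.
by rewrite size_polyDl // size_polyXn.
Qed.

End AdditivePolynomials.

(** * The embedding of the constants *)

Section HahnConstants.
Variable k : fieldType.

Fact hconst_zmod : zmod_morphism (@hconst k).
Proof. by move=> x y; apply: hahn_ext => q /=; case: eqP; rewrite ?subr0. Qed.
Fact hconst_monoid : monoid_morphism (@hconst k).
Proof.
by split=> // x y; rewrite /hconst [RHS](hmonoM 0 0) addr0.
Qed.
HB.instance Definition _ :=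
  GRing.isZmodMorphism.Build k (hahn k) (@hconst k) hconst_zmod.
HB.instance Definition _ :=
  GRing.isMonoidMorphism.Build k (hahn k) (@hconst k) hconst_monoid.

Lemma pchar_hahn p : p \in [pchar k] -> p \in [pchar (hahn k)].
Proof. by rewrite (fmorph_pchar (@hconst k)). Qed.

End HahnConstants.

(** * Values and leading coefficients *)

Section HahnValues.
Variable k : fieldType.
Implicit Types (s t : hahn k) (c d e m q : rat).

Lemma vge0 c : vge (0 : hahn k) c.
Proof. by move=> q; rewrite Defs.coef0 eqxx. Qed.

Lemma vge_le s c d : d <= c -> vge s c -> vge s d.
Proof. by move=> dc sc q /sc; apply: le_trans. Qed.

Lemma vgeN s c : vge s c -> vge (- s) c.
Proof. by move=> sc q; rewrite Defs.coefN oppr_eq0; apply: sc. Qed.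

Lemma vgeD s t c : vge s c -> vge t c -> vge (s + t) c.
Proof.
move=> sc tc q; rewrite Defs.coefD.
have [->|/sc //] := eqVneq (s q) 0; rewrite add0r; exact: tc.
Qed.

Lemma vgeB s t c : vge s c -> vge t c -> vge (s - t) c.
Proof. by move=> sc /vgeN; apply: vgeD. Qed.

Lemma vge_sum I (r : seq I) (P : pred I) (f : I -> hahn k) c :
  (forall i, P i -> vge (f i) c) -> vge (\sum_(i <- r | P i) f i) c.
Proof.
move=> fc; apply: (big_ind (fun s => vge s c)) => //; first exact: vge0.
by move=> x y; exact: vgeD.
Qed.

Lemma vge_const (x : k) : vge (hconst x) 0.
Proof. by move=> q /=; have [->|_] := eqVneq q 0; rewrite ?eqxx. Qed.

Lemma vge_constM (x : k) s c : vge s c -> vge (hconst x * s) c.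
Proof. by move=> /(vgeM (@vge_const x)); rewrite add0r. Qed.

Lemma vge_coef0 s c q : vge s c -> q < c -> s q = 0.
Proof. by move=> sc; apply: contraTeq => /sc; rewrite -leNgt. Qed.

Lemma hval_cases s : s != 0 -> exists m, [/\ hval s = m%:E, s m != 0 & vge s m].
Proof.
move=> s0; rewrite /hval (negPf s0); case: xgetP => [m _ [sm lm]|H].
  by exists m; split=> // q; apply: lm.
have [m sm lm] : exists2 m, supp s m & lbound (supp s) m.
  apply: (suppP s) => //; apply/set0P; apply: contra_neq s0 => s0.
  apply: hahn_ext => q; rewrite Defs.coef0; apply: contrapT => /eqP sq.
  by have : supp s q by []; rewrite s0.
by case: (H m).
Qed.

Lemma hval_lead s m : s m != 0 -> vge s m -> hval s = m%:E.
Proof.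
move=> sm vm; have s0 : s != 0 by apply: contra_neq sm => ->; rewrite Defs.coef0.
have [m' [-> sm' vm']] := hval_cases s0.
by congr (_%:E); apply/le_anti; rewrite vm' // vm.
Qed.

Lemma hval_ge s c : (c%:E <= hval s)%E <-> vge s c.
Proof.
have [->|/hval_cases[m [-> sm vm]]] := eqVneq s 0.
  by split=> _; [exact: vge0|rewrite /hval eqxx leey].
by rewrite lee_fin; split=> [/vge_le|]; [apply|apply].
Qed.

Lemma hval_gt0 s : (0 < hval s)%E <-> exists2 e, 0 < e & vge s e.
Proof.
have [->|/hval_cases[m [-> sm vm]]] := eqVneq s 0.
  by split=> _; [exists 1 => //; exact: vge0|rewrite /hval eqxx ltey].
rewrite lte_fin; split=> [m0|[e e0 /(_ _ sm)]]; first by exists m.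
exact: lt_le_trans.
Qed.

Lemma ex_vge s : exists c, vge s c.
Proof.
have [->|/hval_cases[m [_ _ vm]]] := eqVneq s 0; first by exists 0; exact: vge0.
by exists m.
Qed.

Lemma coefM_lead s t c d : vge s c -> vge t d -> (s * t) (c + d) = s c * t d.
Proof.
move=> sc td; rewrite Defs.coefM (@hmulcE _ _ _ _ [:: c]) //.
  by rewrite big_seq1 addrC addKr.
move=> a /sc ca /td; rewrite inE lerBrDl lerD2r => ac.
by apply/eqP/le_anti; rewrite ca andbT.
Qed.

Lemma coefX_lead s c n : vge s c -> (s ^+ n) (c *+ n) = s c ^+ n.
Proof.
move=> sc; elim: n => [|n IH]; first by rewrite !expr0 mulr0n.
by rewrite !exprS mulrS coefM_lead ?IH //; exact: vge_exp.
Qed.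

(** The leading exponents of [s] and its inverse add up to that of 1, which is 0. *)
Lemma vgeV s m : s m != 0 -> vge s m -> vge s^-1 (- m).
Proof.
move=> sm vm; have s0 : s != 0 by apply: contra_neq sm => ->; rewrite Defs.coef0.
have := s0; rewrite -invr_eq0 => /hval_cases[d [_ sd vd]].
suff -> : - m = d by [].
have : (s * s^-1) (m + d) != 0 by rewrite coefM_lead // mulf_neq0.
have [md _|/negPf md] := eqVneq (m + d) 0; last by rewrite divff //= md eqxx.
by apply/eqP; rewrite eq_sym -addr_eq0 addrC md.
Qed.

Lemma vge_root s c e N :
  (0 < N)%N -> vge (s ^+ N) c -> e *+ N < c -> vge s e.
Proof.
move=> N0 sc eN.
have [->|/hval_cases[m [_ sm vm]]] := eqVneq s 0; first exact: vge0.
apply: (vge_le _ vm); rewrite leNgt; apply/negP => me.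
have : c <= m *+ N by apply: sc; rewrite coefX_lead // expf_neq0.
by rewrite leNgt (lt_trans _ eN) // ltr_pMn2r.
Qed.

(** If [s] had leading exponent [m < e < 0], that of [s^p] would be [p m < m], which [s] cannot
    cancel, so [s^p - s] would have value [p m < e]. *)
Lemma vge_artin_schreier p s e : p \in [pchar k] -> e < 0 -> vge (s ^+ p - s) e -> vge s e.
Proof.
move=> hp e0 ve; have p1 := prime_gt1 (pcharf_prime hp).
have [->|/hval_cases[m [_ sm vm]]] := eqVneq s 0; first exact: vge0.
apply: (vge_le _ vm); rewrite leNgt; apply/negP => me.
have m0 : m < 0 by exact: lt_trans e0.
have pm : m *+ p < m.
  by rewrite -subr_lt0 -[X in _ - X]mulr1n -mulrnBr ?(ltnW p1) // pmulrn_llt0 ?subn_gt0.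
have : e <= m *+ p.
  apply: ve; rewrite Defs.coefD Defs.coefN coefX_lead // (vge_coef0 vm pm) subr0.
  by rewrite expf_neq0.
by rewrite leNgt (lt_trans pm me).
Qed.

End HahnValues.

(** * Completeness and closures in the Hahn field *)

Section HahnClosure.
Variable k : fieldType.
Implicit Types (s t u h x y : hahn k) (W : set (hahn k)) (c : rat).

Lemma ltr_bound c : c < (Num.bound `|c|)%:R.
Proof. by apply: le_lt_trans (ler_norm c) _; apply: archi_boundP. Qed.

(** The coefficient at [q] is constant from any index above [q] on, which defines the limit. Below
    any bound the support of the limit agrees with that of a single term, so it is well-ordered. *)
Lemma hahn_complete (u : nat -> hahn k) :
  (forall N, vge (u N.+1 - u N) N%:R) -> exists h, forall N, vge (h - u N) N%:R.
Proof.
move=> cu.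
have stable q N M : q < N%:R -> (N <= M)%N -> u M q = u N q.
  move=> qN; elim: M => [|M IH]; first by rewrite leqn0 => /eqP ->.
  rewrite leq_eqVlt => /predU1P[-> //|]; rewrite ltnS => NM.
  have qM : q < M%:R by apply: lt_le_trans qN _; rewrite ler_nat.
  have /eqP := vge_coef0 (cu M) qM.
  by rewrite Defs.coefD Defs.coefN subr_eq0 => /eqP ->; exact: IH.
pose f q := u (Num.bound `|q|) q.
have fE q N : q < N%:R -> f q = u N q.
  move=> qN; have qb := ltr_bound q.
  by have [le|/ltnW le] := leqP N (Num.bound `|q|); [exact: stable|rewrite (stable _ _ _ qb)].
have wf : well_ordered [set q | f q != 0].
  move=> B Bf [x Bx]; pose N := Num.bound `|x|.
  have [m [Bm mx] lm] : exists2 m, (B `&` [set y | y <= x]) m &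
      lbound (B `&` [set y | y <= x]) m.
    apply: (suppP (u N)); last by exists x; split => /=.
    move=> y [By yx]; have := Bf _ By; rewrite /= (fE _ N) //.
    exact: le_lt_trans yx (ltr_bound x).
  exists m => // y By; have [yx|xy] := leP y x; first exact: lm.
  exact: le_trans mx (ltW xy).
exists (Hahn wf) => N q; apply: contra_neqT; rewrite -ltNge => qN.
by rewrite Defs.coefD Defs.coefN /= (fE _ _ qN) subrr.
Qed.

(** The closure for the topology of [v]; as [hahn k] is complete, [hclosure K] serves as the
    completion of [K]. *)
Definition hclosure W : set (hahn k) :=
  [set h | forall c, exists2 w, W w & vge (h - w) c].

Lemma sub_hclosure W : W `<=` hclosure W.
Proof. by move=> w Ww c; exists w => //; rewrite subrr; exact: vge0. Qed.

Lemma hclosureS W W' : W `<=` W' -> hclosure W `<=` hclosure W'.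
Proof. by move=> WW h Wh c; have [w /WW] := Wh c; exists w. Qed.

Lemma hclosureK W : hclosure (hclosure W) `<=` hclosure W.
Proof.
move=> h Wh c; have [w /(_ c)[w' Ww' ww'] hw] := Wh c; exists w' => //.
by rewrite -(subrKA w); apply: vgeD.
Qed.

Lemma subfield_hclosure W : subfield W -> subfield (hclosure W).
Proof.
move=> hW; have WE := mem_subfield hW.
have cM x y : hclosure W x -> hclosure W y -> hclosure W (x * y).
  move=> Wx Wy c; have [d xd] := ex_vge x; have [e ye] := ex_vge y.
  (* Precision [c - e] makes up for the factor [y]; precision [d] keeps the value of [x'] at least
     [d]. *)
  have [x' Wx' xx'] := Wx (Num.max (c - e) (d)).
  have [y' Wy' yy'] := Wy (c - d).
  exists (x' * y'); first by apply/WE/rpredM; apply/WE.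
  have -> : x * y - x' * y' = (x - x') * y + x' * (y - y') by ring.
  apply: vgeD.
    apply: vge_le (vgeM xx' ye).
    by rewrite -lerBlDr le_max lexx.
  have x'd : vge x' d.
    rewrite -[x'](subKr x); apply: vgeB => //; apply: vge_le xx'.
    by rewrite le_max lexx orbT.
  by apply: vge_le (vgeM x'd yy'); rewrite addrC subrK.
split=> [|x y /set_mem Wx /set_mem Wy|x y /set_mem Wx /set_mem Wy]; apply/mem_set.
- by apply/sub_hclosure/WE/rpred1.
- move=> c; have [x' Wx' xx'] := Wx c; have [y' Wy' yy'] := Wy c.
  exists (x' - y'); first by apply/WE/rpredB; apply/WE.
  have -> : x - y - (x' - y') = (x - x') - (y - y') by ring.
  exact: vgeB.
apply: cM => // c.
have [->|y0] := eqVneq y 0.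
  by exists 0; [apply/WE/rpred0|rewrite invr0 subrr; exact: vge0].
have [m [_ ym vm]] := hval_cases y0.
(* Precision [m + 1] gives [y'] the leading term of [y]; precision [c + m + m] makes up for the
   denominator [y * y'] in the difference of the inverses. *)
have [y' Wy' yy'] := Wy (Num.max (m + 1) (c + m + m)).
exists y'^-1; first by apply/WE; rewrite rpredV; apply/WE.
have ym' : y' m = y m.
  apply/eqP; rewrite eq_sym -subr_eq0; apply/eqP; apply: (vge_coef0 yy').
  by rewrite lt_max ltrDl ltr01.
have vm' : vge y' m.
  rewrite -[y'](subKr y); apply: vgeB => //; apply: vge_le yy'.
  by rewrite le_max lerDl ler01.
have y'0 : y' != 0 by apply: contra_neq ym => y'0; rewrite -ym' y'0 Defs.coef0.
have -> : y^-1 - y'^-1 = - ((y - y') * (y^-1 * y'^-1)) by field; rewrite y0 y'0.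
apply: vgeN; apply: vge_le (vgeM yy' (vgeM (vgeV ym vm) (vgeV _ vm'))); last by rewrite ym'.
by rewrite -lerBlDr le_max; apply/orP; right; rewrite opprD !opprK addrA.
Qed.

(* If x is at positive distance from W, a convergent sequence w_N + a_N x has
   convergent coefficients a_N. *)
Lemma hclosure_add_line (E W : set (hahn k)) x :
  subfield E -> hclosure E `<=` E -> hclosure W `<=` W ->
  (forall a w w', E a -> W w -> W w' -> W (w + a * w')) -> W 0 ->
  hclosure [set h | exists w a, [/\ W w, E a & h = w + a * x]] `<=`
    [set h | exists w a, [/\ W w, E a & h = w + a * x]].
Proof.
move=> hE cE cW linW W0 h hcl; have EE := mem_subfield hE.
have E0 : E 0 by apply/EE/rpred0.
have [Wx|Wx] := pselect (W x).
  exists h, 0; split=> //; last by rewrite mul0r addr0.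
  apply: cW => c; have [_ [w [a [Ww Ea ->]]] hw] := hcl c.
  by exists (w + a * x) => //; apply: linW.
have [C xC] : exists C : nat, forall w, W w -> ~ vge (x - w) C%:R.
  apply: contrapT => H; apply/Wx/cW => c; apply: contrapT => H'; apply: H.
  exists (Num.bound `|c|) => w Ww xw; apply: H'; exists w => //.
  exact: vge_le (ltW (ltr_bound c)) xw.
(* The surplus [C] makes up for the distance of [x] from [W], so that the coefficients of [x]
   converge with accuracy [N]. *)
have /boolp.choice[w wP] N : exists wa : hahn k * hahn k,
    [/\ W wa.1, E wa.2 & vge (h - (wa.1 + wa.2 * x)) (N + C)%:R].
  have [_ [w [a [Ww Ea ->]]] hw] := hcl (N + C)%:R.
  by exists (w, a).
have Wopp w1 w2 : W w1 -> W w2 -> W (w1 - w2).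
  by move=> W1 W2; rewrite -mulN1r; apply: linW => //; apply/EE; rewrite rpredN1.
have [a aP] : exists a, forall N, vge (a - (w N).2) N%:R.
  apply: hahn_complete => N; set d := (w N.+1).2 - (w N).2.
  have [Ww Ea hw] := wP N; have [Ww' Ea' hw'] := wP N.+1.
  have Ed : E d by apply/EE/rpredB; apply/EE.
  have [->|/hval_cases[m [_ dm vm]]] := eqVneq d 0; first exact: vge0.
  have d0 : d != 0 by apply: contra_neq dm => ->; rewrite Defs.coef0.
  apply: (vge_le _ vm); rewrite leNgt; apply/negP => mN.
  (* If [d] had value below [N], solving for [x] would give this element of [W] closer to [x] than
     [C] allows. The summand [0] fits the form of [linW]. *)
  apply: (xC (0 + - d^-1 * ((w N.+1).1 - (w N).1))).
    by apply: linW => //; [apply/EE; rewrite rpredN rpredV; exact/EE|exact: Wopp].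
  have -> : x - (0 + - d^-1 * ((w N.+1).1 - (w N).1)) =
      d^-1 * ((h - ((w N).1 + (w N).2 * x)) - (h - ((w N.+1).1 + (w N.+1).2 * x))).
    have -> : (w N.+1).2 = d + (w N).2 by rewrite /d subrK.
    by field.
  have hw'' : vge (h - ((w N.+1).1 + (w N.+1).2 * x)) (N + C)%:R.
    by apply: vge_le hw'; rewrite ler_nat leq_add2r.
  apply: vge_le (vgeM (vgeV dm vm) (vgeB hw hw'')).
  by rewrite natrD addrA lerDr addrC subr_ge0 ltW.
have Ea : E a.
  apply: cE => c; exists (w (Num.bound `|c|)).2; first by have [] := wP (Num.bound `|c|).
  exact: vge_le (ltW (ltr_bound c)) (aP _).
exists (h - a * x), a; split=> //; last by rewrite subrK.
apply: cW => c; have [d xd] := ex_vge x.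
pose N := Num.bound `|Num.max c (c - d)|.
have [Ww Ea' hw] := wP N; exists (w N).1 => //.
have cN : Num.max c (c - d) < N%:R by exact: ltr_bound.
have -> : h - a * x - (w N).1 =
    (h - ((w N).1 + (w N).2 * x)) - (a - (w N).2) * x by ring.
apply: vgeB.
  apply: vge_le hw; apply: le_trans (_ : N%:R <= _); last by rewrite ler_nat leq_addr.
  by apply: le_trans (ltW cN); rewrite le_max lexx.
apply: vge_le (vgeM (aP N) xd); rewrite -lerBlDr.
by apply: le_trans (ltW cN); rewrite le_max lexx orbT.
Qed.

(** Induction on [m]: [hclosure_add_line] adds one power of [b] at a time. *)
Lemma hclosure_powers (E : set (hahn k)) b m : subfield E -> hclosure E `<=` E ->
  let W := [set h | exists c : nat -> hahn k, (forall i, E (c i)) /\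
                     h = \sum_(i < m) c i * b ^+ i] in
  hclosure W `<=` W.
Proof.
move=> hE cE /=; have EE := mem_subfield hE.
elim: m => [|m IH] h.
  move=> hcl; exists (fun=> 0); split; first by move=> _; apply/EE/rpred0.
  (* The empty span is zero, and a nonzero [h] with leading exponent [m] is not approximated by 0 to
     precision [m + 1]. *)
  rewrite big_ord0; have [//|/hval_cases[m [_ hm vm]]] := eqVneq h 0.
  have [_ [c [_ ->]]] := hcl (m + 1).
  by rewrite big_ord0 subr0 => /(_ _ hm); rewrite gerDl ler10.
set W := [set h | _] in IH.
have eqW x : (exists c : nat -> hahn k, (forall i, E (c i)) /\
                     x = \sum_(i < m.+1) c i * b ^+ i) <->
    (exists w a, [/\ W w, E a & x = w + a * b ^+ m]).
  split=> [[c [Ec ->]]|[_ [a [[c [Ec ->]] Ea ->]]]].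
    by rewrite big_ord_recr; exists (\sum_(i < m) c i * b ^+ i), (c m); split=> //; exists c.
  exists (fun i => if (i < m)%N then c i else a); split.
    by move=> i; case: ifP.
  rewrite big_ord_recr /= ltnn; congr (_ + _).
  by apply: eq_bigr => i _; rewrite ltn_ord.
move=> hcl; apply/eqW; apply: (hclosure_add_line hE cE IH).
- move=> a _ _ Ea [c [Ec ->]] [c' [Ec' ->]].
  exists (fun i => c i + a * c' i); split.
    by move=> i; apply/EE/rpredD; [|apply: rpredM]; apply/EE.
  rewrite mulr_sumr -big_split; apply: eq_bigr => i _ /=.
  by rewrite mulrDl mulrA.
- exists (fun=> 0); split; first by move=> _; apply/EE/rpred0.
  by rewrite big1 // => i _; rewrite mul0r.
by apply: hclosureS hcl => x /eqW.
Qed.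

End HahnClosure.

(** * Artin-Schreier and additive equations over subfields of the Hahn field *)

Section HenselianHahn.
Variables (k : closedFieldType) (p : nat).
Hypothesis hp : p \in [pchar k].
Variables (K : set (hahn k)) (hK : subfield K).
Hypothesis Kconst : forall x, K (hconst x).
Implicit Types (x y z w : hahn k) (e : rat).

Let hpH : p \in [pchar (hahn k)] := pchar_hahn hp.
Let p1 : (1 < p)%N := prime_gt1 (pcharf_prime hp).
Let KE := mem_subfield hK.

(** The equation is first solved in [k] for the coefficient of [z] at 0; the derivative of
    [X^p - X - z] is -1, so Hensel's lemma lifts this solution. *)
Lemma henselian_artin_schreier z : henselian K -> K z -> vge z 0 ->
  exists2 x, K x & x ^+ p - x = z.
Proof.
move=> hensK Kz vz.
have [c] : exists c, root ('X^p - 'X - (z 0)%:P) c.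
  by apply/closed_rootP; rewrite artin_schreier_size // eqSS -lt0n ltnW.
rewrite /root !hornerE subr_eq0 => /eqP cz.
pose f : {poly hahn k} := 'X^p - 'X - z%:P.
have fE i : f`_i = (i == p)%:R - (i == 1)%:R - (if i == 0%N then z else 0).
  by rewrite !coefB coefXn coefX coefC.
have vnat (b : bool) : vge (b%:R : hahn k) 0.
  by case: b; [exact: (@vge_const _ 1)|exact: vge0].
have [x [[Kx _] fx _]] : exists b, [/\ val_ring K b, root f b &
    (0 < hval (b - hconst c)%R)%E].
  apply: hensK.
  - apply/(all_nthP 0) => i _; apply/mem_set; rewrite fE; split.
      apply/KE; rewrite !rpredB ?rpred_nat //.
      by case: ifP => _; [exact/KE|exact: rpred0].
    apply/hval_ge; apply: vgeB; first exact: vgeB.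
    by case: ifP => _ //; exact: vge0.
  - exact: artin_schreier_monic hpH _.
  - by split; [exact: Kconst|apply/hval_ge/vge_const].
  - rewrite /f !hornerE -rmorphXn -rmorphB /= cz.
    apply/hval_gt0; set u := _ - _.
    have vu : vge u 0 by apply: vgeB => //; exact: vge_const.
    have [->|/hval_cases[m [_ um vm]]] := eqVneq u 0.
      by exists 1 => //; exact: vge0.
    exists m => //; rewrite lt_neqAle vu // andbT eq_sym.
    apply: contra_neq um => ->.
    by rewrite Defs.coefD Defs.coefN /= subrr.
  rewrite /f !derivB derivXn derivX derivC subr0 !hornerE.
  rewrite hornerMn -mulr_natr (pcharf0 hpH) mulr0 sub0r.
  have vN1 : vge (- 1 : hahn k) 0 by apply: vgeN; exact: (@vge_const _ 1).
  apply: (hval_lead _ vN1).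
  by rewrite Defs.coefN oppr_eq0 /= oner_eq0.
exists x => //; move: fx; rewrite /root /f !hornerE subr_eq0 => /eqP.
exact.
Qed.

(** If a combination [x] lies in the closure, choose [x'] in [K] with [v(x - x') >= 0]. The image of
    [x - x'] under [z^p - z] is in [K] with nonnegative value, hence is that of some [w] in [K].
    Then [x - x' - w] is in the prime field, and [x] is in [K]. *)
Lemma independent_hclosure n (alpha : 'I_n -> hahn k) : henselian K ->
  (forall i, K (alpha i ^+ p - alpha i)) ->
  as_independent p K alpha -> as_independent p (hclosure K) alpha.
Proof.
move=> hensK Kalpha indep e Ke; apply: indep.
set x := \sum_i _ in Ke *.
have Kx : K (x ^+ p - x).
  apply/KE; rewrite (wp_sum hpH); apply: rpred_sum => i _.
  by rewrite (wp_mulrn hpH) rpredMn //; apply/KE.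
have [x' Kx' xx'] := Ke 0.
have vxx' : vge ((x - x') ^+ p - (x - x')) 0.
  by apply: vgeB => //; have := @vge_exp _ _ _ p xx'; rewrite mul0rn.
have [|w Kw ww] := henselian_artin_schreier hensK _ vxx'.
  by rewrite (wp_sub hpH); apply/KE/rpredB; [exact/KE|rewrite rpredB ?rpredX //; exact/KE].
have [|t tE] := @pchar_fixed_nat _ _ hpH (x - x' - w).
  by apply/eqP; rewrite -subr_eq0 (wp_sub hpH) ww subrr.
have -> : x = x' + w + t%:R by rewrite -tE; ring.
by apply/KE; rewrite !rpredD ?rpred_nat //; apply/KE.
Qed.

Lemma approx_artin_schreier x e : perfect_char p K -> K (x ^+ p - x) -> e < 0 ->
  exists2 b, K b & vge (x - b) e.
Proof.
move=> perfK Kx e0; have [c xc] := ex_vge (x ^+ p - x).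
(* If [s^p = r], subtracting [s] from [x - b] turns [r] into [r - (s^p - s) = s]. *)
have step J : exists b r, [/\ K b, K r, (x - b) ^+ p - (x - b) = r &
    r ^+ (p ^ J) = x ^+ p - x].
  elim: J => [|J [b [r [Kb Kr br rx]]]].
    by exists 0, (x ^+ p - x); rewrite subr0 expr1; split=> //; apply/KE/rpred0.
  have [s Ks sr] := perfK _ Kr; exists (b + s), s; split=> //.
  - by apply/KE/rpredD; apply/KE.
  - by rewrite opprD addrA (wp_sub hpH) br -sr subKr.
  - by rewrite expnS exprM sr.
(* Since [p^J > c / e] and [e < 0], the value of [r], at least [c / p^J], exceeds [e]. *)
pose J := Num.bound `|c / e|; have [b [r [Kb Kr br rx]]] := step J.
exists b => //; apply: (vge_artin_schreier hp e0); rewrite br.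
apply: (@vge_root _ _ c _ (p ^ J)); first by rewrite expn_gt0 ltnW.
  by rewrite rx.
rewrite -mulr_natl -ltr_ndivrMr //; apply: lt_le_trans (ltr_bound _) _.
by rewrite ler_nat ltnW // ltn_expl.
Qed.

(* Iterate w' |-> a_0^-1 (A(w) - sum_(j >= 1) a_j w'^(p^j)), which at least
   doubles the valuation of w - w'. *)
Lemma additive_root_hclosure (R : set (hahn k)) (a : nat -> k) n w e :
  subfield R -> (forall c, R (hconst c)) -> a 0%N != 0 -> 0 < e -> vge w e ->
  R (additive_eval p (fun j => hconst (a j)) n w) -> hclosure R w.
Proof.
move=> hR Rconst a0 e0 we; set z := additive_eval _ _ _ _ => Rz.
have RE := mem_subfield hR.
pose g x := \sum_(j < n) hconst (a j.+1) * x ^+ (p ^ j.+1).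
have zE : z = hconst (a 0%N) * w + g w.
  by rewrite /z /additive_eval big_ord_recl expn0 expr1.
(* A gain of [e] at each iteration is enough, so only linear growth is recorded. *)
have step N : exists2 w', R w' & vge (w - w') (e *+ N.+1).
  elim: N => [|N [w' Rw' ww']]; first by exists 0; [apply/RE/rpred0|rewrite subr0].
  set d := e *+ N.+1 in ww'.
  exists ((hconst (a 0%N))^-1 * (z - g w')).
    apply/RE; rewrite rpredM ?rpredV ?rpredB //; [exact/RE|exact/RE|].
    by apply: rpred_sum => j _; rewrite rpredM ?rpredX //; exact/RE.
  have h0 : hconst (a 0%N) != 0 by rewrite fmorph_eq0.
  have -> : w - (hconst (a 0%N))^-1 * (z - g w') =
      hconst (- (a 0%N)^-1) * (g w - g w').
    by rewrite rmorphN fmorphV zE; field.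
  apply: vge_constM; rewrite -sumrB; apply: vge_sum => j _.
  rewrite -mulrBr -(frobenius_iterB hpH); apply: vge_constM.
  apply: vge_le (@vge_exp _ _ _ (p ^ j.+1) ww').
  have d0 : 0 <= d by rewrite mulrn_wge0 // ltW.
  apply: le_trans (_ : d *+ 2 <= _).
    by rewrite mulrS mulr2n lerD2r /d mulrS lerDl mulrn_wge0 // ltW.
  have le2 : (2 <= p ^ j.+1)%N.
    by apply: leq_trans p1 _; rewrite expnS leq_pmulr // expn_gt0 ltnW.
  by rewrite -subr_ge0 -mulrnBr // mulrn_wge0.
move=> c; pose N := Num.bound `|c / e|; have [w' Rw' ww'] := step N.
exists w' => //; apply: vge_le ww'.
rewrite -mulr_natl -ler_pdivrMr //; apply: le_trans (ltW (ltr_bound _)) _.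
by rewrite ler_nat.
Qed.

End HenselianHahn.

(** A finite extension of a complete field is complete: the first [m] powers of [b] span it, and
    [hclosure_powers] shows that their span is closed. *)
Lemma adjoin_powers_closed (k : fieldType) (E : set (hahn k)) b m (q : {poly hahn k}) :
  subfield E -> hclosure E `<=` E ->
  q \is a polyOver [in E] -> size q = m.+1 -> root q b ->
  hclosure (adjoin E [set b]) `<=` adjoin E [set b] /\
  spanned E (adjoin E [set b]) m.
Proof.
move=> hE cE qE sq qb; have hA := subfield_adjoin E [set b].
have powers : adjoin E [set b] `<=` [set h | exists c : nat -> hahn k,
    (forall i, E (c i)) /\ h = \sum_(i < m) c i * b ^+ i].
  move=> h /(adjoin_root_poly hE qE sq qb)[P [/(polyOver_subfield hE) PE sP ->]].
  by exists (fun i => P`_i); split=> //; rewrite (horner_coef_wide _ sP).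
split.
  move=> h /(hclosureS powers)/(hclosure_powers hE cE)[c [Ec ->]].
  apply/(mem_subfield hA); apply: rpred_sum => i _; apply: rpredM; last apply: rpredX.
    by apply/(mem_subfield hA); apply: adjoin_base.
  by apply/(mem_subfield hA); apply: adjoin_gen.
exists 'I_m, (fun i : 'I_m => b ^+ i); split; first exact: card_ord.
by move=> h /powers[c [Ec ->]]; exists (fun i : 'I_m => c i); split.
Qed.

Lemma elt_degree1 (F : fieldType) (E : set F) (hE : subfield E) b :
  elt_degree E b 1 <-> E b.
Proof.
split=> [[q [/(polyOver_subfield hE) qE /monicP qm qb sq _]]|Eb].
  apply/(mem_subfield hE); move: qb; rewrite /root horner_coef sq.
  rewrite big_ord_recl big_ord1 expr0 expr1 mulr1.
  have -> : q`_(lift ord0 ord0) = 1 by rewrite -qm lead_coefE sq.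
  rewrite mul1r addrC addr_eq0 => /eqP ->; rewrite rpredN.
  exact/(mem_subfield hE).
exists ('X - b%:P); split.
- suff : 'X - b%:P \is a polyOver (subfield_pred hE) by [].
  by rewrite polyOverXsubC; exact/(mem_subfield hE).
- exact: monicXsubC.
- by rewrite root_XsubC.
- exact: size_XsubC.
- move=> q _ q0 qb; rewrite size_XsubC.
  rewrite -(size_XsubC b); apply: dvdp_leq => //.
  by rewrite dvdp_XsubCl.
Qed.

(** * The generator [theta], its degree and its depth *)

Section GenericGenerator.
Variables (k : closedFieldType) (p : nat).
Hypothesis hp : p \in [pchar k].
Variables (K : set (hahn k)) (hK : subfield K).
Hypotheses (Kconst : forall x, K (hconst x)) (hensK : henselian K)
  (perfK : perfect_char p K).
Variables (n : nat) (alpha : 'I_n -> hahn k).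
Hypotheses (Kalpha : forall i, K (alpha i ^+ p - alpha i))
  (indep : as_independent p K alpha).
Variable x : k.
Hypothesis x_sep :
  injective (fun t : {ffun 'I_n -> 'I_p} => \sum_(i < n) x ^+ i * (t i)%:R).

Let hpH : p \in [pchar (hahn k)] := pchar_hahn hp.
Let KE := mem_subfield hK.
Let c (i : 'I_n) : hahn k := hconst (x ^+ i).
Let theta := \sum_i c i * alpha i.

Let c_inj : injective (fun t : {ffun 'I_n -> 'I_p} => \sum_i c i * (t i)%:R).
Proof.
move=> t u tu; apply/x_sep/(@fmorph_inj _ _ (@hconst k)).
rewrite !rmorph_sum; under eq_bigr do rewrite rmorphM rmorph_nat.
by under [RHS]eq_bigr do rewrite rmorphM rmorph_nat.
Qed.

Lemma generator_min_size (P : {poly hahn k}) :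
  P \is a polyOver [in K] -> P != 0 -> root P theta -> (p ^ n < size P)%N.
Proof.
move=> PK P0 Pt.
apply: (generic_combination_size hpH hK Kalpha indep _ c_inj PK Pt P0) => i.
exact: Kconst.
Qed.

Lemma generator_min_size_hclosure (P : {poly hahn k}) :
  P \is a polyOver [in hclosure K] -> P != 0 -> root P theta ->
  (p ^ n < size P)%N.
Proof.
move=> PK P0 Pt; have indep' := independent_hclosure hp hK Kconst hensK Kalpha indep.
apply: (generic_combination_size hpH (subfield_hclosure hK) _ indep' _ c_inj PK Pt P0) => i.
  exact/sub_hclosure/Kalpha.
exact/sub_hclosure/Kconst.
Qed.

(** The additive polynomial is chosen to kill every [x ^+ i], so [additive_eval_mul] applies to each
    summand of [theta]. *)
Lemma ex_additive_generator : exists a : nat -> k,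
  [/\ a 0%N != 0, a n = 1 &
    K (additive_eval p (fun j => hconst (a j)) n theta)].
Proof.
have [a [a0 an aP]] := ex_additive_eval hp (fun i => x ^+ i) n.
exists a; split=> //; rewrite (additive_eval_sum hpH); apply/KE/rpred_sum => i _.
apply/KE/(additive_eval_mul hpH hK) => //; first exact: Kconst.
have := congr1 (@hconst k) (aP i (ltn_ord i)).
rewrite rmorph0 => <-; rewrite rmorph_sum; apply: eq_bigr => j _.
by rewrite rmorphM rmorphXn.
Qed.

(** With [A] this additive polynomial, [A(X) - A(theta)] is a monic polynomial over [K] of degree
    [p^n], and [generator_min_size] makes it minimal. *)
Lemma generator_degree : elt_degree K theta (p ^ n).
Proof.
have [a [_ an Ka]] := ex_additive_generator.
set b := (fun j => _) in Ka.
have bn : b n = 1 by rewrite /b an rmorph1.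
have [Pm Ps] := additive_poly_monic hpH (additive_eval p b n theta) bn.
exists (additive_poly p b n (additive_eval p b n theta)); split=> //.
- by apply: (additive_poly_over _ hK) => // j; exact: Kconst.
- by rewrite /root horner_additive_poly subrr.
by move=> q qK q0 qt; rewrite Ps; exact: generator_min_size.
Qed.

Lemma generator_approx e : e < 0 -> exists2 b, K b & vge (theta - b) e.
Proof.
move=> e0.
have /boolp.choice[b bP] i : exists b, K b /\ vge (alpha i - b) e.
  have [b Kb vb] := approx_artin_schreier hp hK perfK (Kalpha i) e0.
  by exists b.
exists (\sum_i c i * b i).
  apply/KE; apply: rpred_sum => i _; apply: rpredM; apply/KE; first exact: Kconst.
  exact: (bP i).1.
rewrite -sumrB; apply: vge_sum => i _; rewrite -mulrBr.
exact: vge_constM (bP i).2.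
Qed.

(* The approximant b may be translated by a constant, so that theta - b has
   positive value; then theta lies in the completion of K(b), whose degree
   over the completion of K is at most m. *)
Lemma generator_approx_degree b m :
  elt_degree K b m -> vge (theta - b) 0 -> (p ^ n <= m)%N.
Proof.
move=> [q [qK _ qb sq _]] vb.
have [a [a0 an Ka]] := ex_additive_generator.
(* Removing the coefficient at exponent 0 leaves only positive exponents in [w]. *)
pose c0 := (theta - b) 0; pose w := theta - b - hconst c0.
have [e e0 we] : exists2 e, 0 < e & vge w e.
  have vw : vge w 0 by apply: vgeB => //; exact: vge_const.
  have [->|/hval_cases[e [_ we ve]]] := eqVneq w 0; first by exists 1 => //; exact: vge0.
  exists e => //; rewrite lt_neqAle vw // andbT eq_sym.
  by apply: contra_neq we => ->; rewrite Defs.coefD Defs.coefN /= subrr.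
have hKh := subfield_hclosure hK.
have hA := subfield_adjoin (hclosure K) [set b].
have AE := mem_subfield hA.
have Kh y : K y -> adjoin (hclosure K) [set b] y.
  by move=> Ky; apply: adjoin_base; exact: sub_hclosure.
have [clA sA] : hclosure (adjoin (hclosure K) [set b]) `<=` adjoin (hclosure K) [set b] /\
    spanned (hclosure K) (adjoin (hclosure K) [set b]) m.
  apply: adjoin_powers_closed sq qb => //; first exact: hclosureK.
  apply/(polyOver_subfield hKh) => i; apply: sub_hclosure; move: i.
  exact/(polyOver_subfield hK).
have Aw : adjoin (hclosure K) [set b] w.
  apply: clA; apply: (additive_root_hclosure hp hA _ a0 e0 we).
    by move=> y; exact: Kh (Kconst y).
  (* By additivity [A(w) = A(theta) - A(b + c0)], and [A(theta)] is in [K]. *)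
  rewrite /w -addrA -opprD (additive_evalB hpH); apply/AE/rpredB.
    by apply/AE; exact: Kh Ka.
  apply: rpred_sum => j _; apply: rpredM; first by apply/AE; exact: Kh (Kconst _).
  apply: rpredX; apply: rpredD; last by apply/AE; exact: Kh (Kconst _).
  by apply/AE; apply: adjoin_gen.
have At : theta \in subfield_pred hA.
  have -> : theta = w + hconst c0 + b by rewrite /w !subrK.
  apply: rpredD; [apply: rpredD|]; apply/AE => //; first exact: Kh (Kconst _).
  exact: adjoin_gen.
have [|P [PK P0 sP Pt]] := spanned_power_root hKh (a := theta) sA.
  by move=> i; apply/AE/rpredX.
by rewrite -ltnS; apply: leq_trans sP; exact: generator_min_size_hclosure.
Qed.

(** The chain of degrees jumps from 1 directly to [p^n], because [generator_approx_degree] excludes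
    any intermediate degree. *)
Lemma generator_depth : (0 < n)%N -> elt_depth K theta 1.
Proof.
move=> n0; have p1 := prime_gt1 (pcharf_prime hp).
have pn1 : (1 < p ^ n)%N by rewrite -{1}(expn0 p) ltn_exp2l.
have tK : ~ K theta.
  move=> /(elt_degree1 hK)[P [PK Pm Pt sP _]].
  have := generator_min_size PK (monic_neq0 Pm) Pt.
  by rewrite sP ltnS leqNgt pn1.
exists (p ^ n)%N, (fun l => if l == 0%N then 1%N else (p ^ n)%N); split=> //.
  exact: generator_degree.
move=> [|//] _ /=; split.
  split; first by rewrite pn1 leqnn.
  (* This value is reached by [b = theta], while the values over [K] are finite since [theta] is not
     in [K]. *)
  exists +oo%E.
    exists theta; last by rewrite /hval subrr eqxx.
    split; last exact: generator_degree.
    have [P [PK Pm Pt _ _]] := generator_degree.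
    by exists P; split=> //; exact: monic_neq0.
  move=> _ [b [_ /(elt_degree1 hK) Kb] <-].
  have : theta - b != 0 by rewrite subr_eq0; apply/eqP => tb; rewrite tb in tK.
  by move=> /hval_cases[m [-> _ _]]; rewrite ltey.
move=> m [_ [_ [b [_ bm] <-] bmax]].
apply: (generator_approx_degree bm).
have [->|/hval_cases[e [he _ ve]]] := eqVneq (theta - b) 0; first exact: vge0.
(* A negative value [e] would be matched or exceeded by some [b0] in [K], against [bmax]. *)
apply: (vge_le _ ve); rewrite leNgt; apply/negP => e0.
have [b0 Kb0 /hval_ge] := generator_approx e0.
rewrite -he leNgt => /negP; apply; apply: bmax; exists b0 => //.
split; last exact/(elt_degree1 hK).
have [P [PK Pm Pb _ _]] := (elt_degree1 hK b0).2 Kb0.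
by exists P; split=> //; exact: monic_neq0.
Qed.

(** Any [y] in [L] and the powers of [theta] below [p^n] are [p^n + 1] elements of a space of
    dimension at most [p^n]. In a dependence the coefficient of [y] is nonzero, as [theta] is a root
    of no nonzero polynomial over [K] of size at most [p^n]; so [y] is in [K(theta)]. *)
Lemma generator_adjoin (L : set (hahn k)) :
  L = compositum (fun i => adjoin K [set alpha i]) -> (0 < n)%N ->
  L = adjoin K [set theta].
Proof.
move=> LE n0; have hL : subfield L by rewrite LE; exact: subfield_smallest.
have Lgen i y : adjoin K [set alpha i] y -> L y.
  by move=> yi; rewrite LE => D [_ +]; apply; exists i.
have LK : K `<=` L by move=> y Ky; apply: (Lgen (Ordinal n0)); exact: adjoin_base.
have Ltheta : L theta.
  apply/(mem_subfield hL); apply: rpred_sum => i _; apply: rpredM.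
    exact/(mem_subfield hL)/LK/Kconst.
  by apply/(mem_subfield hL)/(Lgen i); apply: adjoin_gen.
apply/seteqP; split; last by apply: adjoin_min => // _ ->.
pose D := adjoin_list K (map alpha (enum 'I_n)).
have sD : spanned K D (1 * p ^ size (map alpha (enum 'I_n))).
  apply: (spanned_adjoin_list hpH hK); last exact: spanned_self.
  by move=> _ /mapP[i _ ->].
rewrite mul1n size_map size_enum_ord in sD.
have hD : subfield D by exact: subfield_adjoin_list.
have LD : L `<=` D.
  rewrite LE => y; apply; split=> // z [i _].
  apply: adjoin_min => //; first exact: adjoin_list_base.
  by move=> _ ->; apply: adjoin_list_gen; apply: map_f; rewrite mem_enum.
move=> y Ly; pose N := (p ^ n)%N.
pose E (i : 'I_N.+1) := if (i < N)%N then theta ^+ i else y.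
have DE i : D (E i).
  rewrite /E; case: ifP => _; last exact: LD.
  by apply/(mem_subfield hD); apply: rpredX; apply/(mem_subfield hD)/LD.
have := spanned_dependent hK sD DE; rewrite card_ord.
move=> /(_ (ltnSn _))[d [Kd [i0 di0]]].
rewrite big_ord_recr /= {2}/E /= ltnn.
pose P := \poly_(j < N) d (inord j).
have PK : P \is a polyOver [in K].
  apply/(polyOver_subfield hK) => j; rewrite coef_poly; case: ifP => // _.
  exact/KE/rpred0.
have PE : \sum_(i < N) d (widen_ord (leqnSn N) i) * E (widen_ord (leqnSn N) i) =
    P.[theta].
  rewrite (@horner_coef_wide _ N) ?size_poly //; apply: eq_bigr => j _.
  rewrite coef_poly /E /= ltn_ord; congr (d _ * _); apply/val_inj.
  by rewrite /= inordK // ltnS ltnW.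
rewrite {}PE => dsum.
have hT := subfield_adjoin K [set theta]; have TE := mem_subfield hT.
have TK z : K z -> z \in subfield_pred hT by move=> Kz; apply/TE; exact: adjoin_base.
have [dN|dN] := eqVneq (d ord_max) 0.
  have P0 : P != 0.
    apply: contra_neq di0 => P0; have := ltn_ord i0; rewrite ltnS leq_eqVlt.
    case/predU1P => [i0N|i0N]; first by rewrite -dN; congr d; apply/val_inj.
    have := coef_poly N (fun j => d (inord j)) i0.
    by rewrite -/P P0 coef0 i0N inord_val.
  have : (p ^ n < size P)%N.
    by apply: generator_min_size => //; rewrite /root -dsum dN mul0r addr0.
  by rewrite ltnNge size_poly.
have Ts : P.[theta] \in subfield_pred hT.
  apply: rpred_horner; last by apply/TE; apply: adjoin_gen.
  by apply/polyOverP => j; apply: TK; move: j; apply/(polyOver_subfield hK).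
have -> : y = - P.[theta] / d ord_max.
  apply: (mulIf dN); rewrite mulfVK // mulrC; apply/eqP.
  by rewrite -addr_eq0 addrC dsum.
by apply/TE/rpred_div; [rewrite rpredN|exact/TK].
Qed.

End GenericGenerator.

Theorem theorem3p15 (R : realType) (k : closedFieldType) (p : nat)
    (hp : p \in [pchar k])
    (K : set (hahn k))
    (hK : subfield K)
    (hyK : ratfun k `<=` K)
    (hensK : henselian K)
    (perfK : perfect_char p K)
    (limK : no_finite_limits R K)
    (n : nat) (hn : (0 < n)%N)
    (alpha : 'I_n -> hahn k)
    (hAS : forall i, artin_schreier p K (alpha i))
    (hLD : linearly_disjoint K alpha)
    (L : set (hahn k))
    (hL : L = compositum (fun i => adjoin K [set alpha i])) :
  ext_depth K L 1.
Proof.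
have Kconst x : K (hconst x).
  by apply: hyK => D [_]; apply; left; exists x.
have Kalpha i : K (alpha i ^+ p - alpha i) by have [] := hAS i.
have alphaK i : ~ K (alpha i).
  by have [_ _ H] := hAS i; move/H; rewrite eqxx.
have indep : as_independent p K alpha.
  exact: (linearly_disjoint_independent (pchar_hahn hp) hK Kalpha alphaK hLD).
have [x x_sep] := ex_separating_power n hp.
split.
  exists (\sum_(i < n) hconst (x ^+ i) * alpha i); split.
  - have [P [PK Pm Pt _ _]] := generator_degree hp hK Kconst Kalpha indep x_sep.
    by exists P; split=> //; exact: monic_neq0.
  - exact: (generator_adjoin hp hK Kconst Kalpha indep x_sep hL hn).
  - exact: (generator_depth hp hK Kconst hensK perfK Kalpha indep x_sep hn).
(* Depth 0 would make [theta] of degree 1, so [L = K], although [L] contains an [alpha i] outside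
   [K]. *)
move=> [[theta [_ LE [m [d [tm d0 dm _]]]]]|//].
rewrite -dm d0 in tm; have /(elt_degree1 hK) Kt := tm.
exfalso; apply: (alphaK (Ordinal hn)).
apply: (@adjoin_min _ K [set theta]) => //; first by move=> _ ->.
rewrite -LE hL => D [_]; apply; exists (Ordinal hn) => //.
exact: adjoin_gen.
Qed.
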